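(* Suppose that $\lambda>\lambda_c$. Then there exists a unique $x=x_*=x_*(\lambda)\in(0,1)$ for which $$\operatorname{Re}\int_{z_\lambda(x_* )}^{1}\sqrt{Q(s;\lambda,x_* )}\,ds=0 .$$ Furthermore, $\lim_{\lambda\to+\infty}x_*(\lambda)=1$.
   Context: The number $\lambda_c\approx 1.32549$ is the unique positive solution of $2\log\left(\frac{2+\sqrt{\lambda^2+4}}{\lambda}\right)-\sqrt{\lambda^2+4}=0$. For $\lambda>0$ and $x\in\mathbb R$ set $$z_\lambda(x)=x+\frac{2i}{\lambda},\qquad Q(z;\lambda,x)=-\frac{\lambda^2}{4}\,\frac{(z-z_\lambda(x))(z+\overline{z_\lambda(x)})}{z^2-1}.$$ The integral is taken along the straight line segment from $z_\lambda(x)$ to $1$, with any branch of the square root that varies analytically along the (interior of the) segment; the condition does not depend on the choice of branch. *)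

(* Defs.v *)
From Stdlib Require Import Reals Ranalysis5 Lra.
From Coquelicot Require Import Coquelicot.
Open Scope R_scope.

Definition critical_eq (l : R) : Prop :=
  2 * ln ((2 + sqrt (l ^ 2 + 4)) / l) - sqrt (l ^ 2 + 4) = 0.

(* [iota] is Coquelicot's definite description operator; [lambda_c_correct]
   shows that the description is proper. *)
Definition lambda_c : R :=
  iota (T := R_CompleteSpace) (fun l : R => 0 < l /\ critical_eq l).

Lemma critical_decreasing (a b : R) : 0 < a -> a < b ->
  2 * ln ((2 + sqrt (b ^ 2 + 4)) / b) - sqrt (b ^ 2 + 4) <
  2 * ln ((2 + sqrt (a ^ 2 + 4)) / a) - sqrt (a ^ 2 + 4).
Proof.
intros Ha Hab.
assert (Hs : sqrt (a ^ 2 + 4) < sqrt (b ^ 2 + 4)) by (apply sqrt_lt_1; nra).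
pose proof (sqrt_pos (a ^ 2 + 4)) as Pa.
pose proof (sqrt_pos (b ^ 2 + 4)) as Pb.
assert (Ea : sqrt (a ^ 2 + 4) * sqrt (a ^ 2 + 4) = a ^ 2 + 4)
  by (apply sqrt_sqrt; nra).
assert (Eb : sqrt (b ^ 2 + 4) * sqrt (b ^ 2 + 4) = b ^ 2 + 4)
  by (apply sqrt_sqrt; nra).
set (sa := sqrt (a ^ 2 + 4)) in *.
set (sb := sqrt (b ^ 2 + 4)) in *.
assert (H : a * sb < b * sa).
{ apply Rsqr_incrst_0; [|apply Rmult_le_pos; lra|apply Rmult_le_pos; lra].
  unfold Rsqr.
  replace (a * sb * (a * sb)) with (a * a * (sb * sb)) by ring.
  replace (b * sa * (b * sa)) with (b * b * (sa * sa)) by ring.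
  rewrite Ea, Eb; nra. }
assert (Hl : ln ((2 + sb) / b) < ln ((2 + sa) / a)).
{ apply ln_increasing.
  - apply Rdiv_lt_0_compat; lra.
  - apply Rmult_lt_reg_r with (a * b); [nra|].
    replace ((2 + sb) / b * (a * b)) with ((2 + sb) * a) by (field; lra).
    replace ((2 + sa) / a * (a * b)) with ((2 + sa) * b) by (field; lra).
    nra. }
lra.
Qed.

Lemma critical_exists : exists l : R, 0 < l /\ critical_eq l.
Proof.
pose (g := fun l : R => sqrt (l ^ 2 + 4) - 2 * ln ((2 + sqrt (l ^ 2 + 4)) / l)).
destruct (IVT_interv g (2 / 5) 2) as [l [Hl Hg]].
- intros l Hl.
  assert (P : 0 < l ^ 2 + 4) by nra.
  pose proof (sqrt_lt_R0 _ P).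
  apply continuity_pt_filterlim, (ex_derive_continuous g).
  unfold g; auto_derive.
  repeat split; try lra; try (simpl in *; lra).
  apply Rdiv_lt_0_compat; simpl in *; lra.
- lra.
- unfold g.
  assert (E : sqrt ((2 / 5) ^ 2 + 4) * sqrt ((2 / 5) ^ 2 + 4) = (2 / 5) ^ 2 + 4)
    by (apply sqrt_sqrt; lra).
  pose proof (sqrt_pos ((2 / 5) ^ 2 + 4)).
  set (s := sqrt ((2 / 5) ^ 2 + 4)) in *.
  assert (2 < s < 4) by nra.
  assert (exp 2 <= 9).
  { replace 2 with (1 + 1) by lra. rewrite exp_plus. pose proof exp_le_3. pose proof (exp_pos 1). nra. }
  assert (2 < ln ((2 + s) / (2 / 5))).
  { apply Rle_lt_trans with (ln (exp 2)); [rewrite ln_exp; lra|].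
    apply ln_increasing; [apply exp_pos|].
    replace ((2 + s) / (2 / 5)) with ((2 + s) * (5 / 2)) by field. lra. }
  lra.
- unfold g.
  assert (E : sqrt (2 ^ 2 + 4) * sqrt (2 ^ 2 + 4) = 2 ^ 2 + 4)
    by (apply sqrt_sqrt; lra).
  pose proof (sqrt_pos (2 ^ 2 + 4)).
  set (s := sqrt (2 ^ 2 + 4)) in *.
  assert (2 < s) by nra.
  assert (ln ((2 + s) / 2) < s / 2).
  { rewrite <- (ln_exp (s / 2)). apply ln_increasing; [lra|].
    pose proof (exp_ineq1 (s / 2)). lra. }
  lra.
- exists l; unfold critical_eq, g in *; split; lra.
Qed.

Lemma lambda_c_correct :
  unique (fun l : R => 0 < l /\ critical_eq l) lambda_c.
Proof.
assert (U : forall a b : R,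
  0 < a /\ critical_eq a -> 0 < b /\ critical_eq b -> a = b).
{ unfold critical_eq; intros a b [Ha Ea] [Hb Eb].
  destruct (Rtotal_order a b) as [H | [H | H]]; [|exact H|].
  - pose proof (critical_decreasing a b Ha H); lra.
  - pose proof (critical_decreasing b a Hb H); lra. }
assert (S : 0 < lambda_c /\ critical_eq lambda_c).
{ apply (iota_correct (V := R_CompleteNormedModule)
    (fun l : R => 0 < l /\ critical_eq l)).
  destruct critical_exists as [l Hl].
  exists l; split; [exact Hl|].
  intros b Hb; exact (U l b Hl Hb). }
split; [exact S|].
intros b Hb; exact (U _ b S Hb).
Qed.

Definition z_pt (lambda x : R) : C := (RtoC x + RtoC 2 * Ci / RtoC lambda)%C.

Definition Q (lambda x : R) (z : C) : C :=
  (- RtoC (lambda ^ 2 / 4) *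
   ((z - z_pt lambda x) * (z + Cconj (z_pt lambda x)) / (z ^ 2 - RtoC 1)))%C.

Definition segment (a b : C) (t : R) : C := (a + RtoC t * (b - a))%C.

(* [w] is a branch of the square root of [f] that is holomorphic on some open
   neighbourhood of the open segment from [a] to [b]. *)
Definition sqrt_branch (f : C -> C) (a b : C) (w : C -> C) : Prop :=
  exists U : C -> Prop,
    open U /\
    (forall t : R, 0 < t < 1 -> U (segment a b t)) /\
    (forall z : C, U z ->
       ex_derive (K := C_AbsRing) (V := C_NormedModule) w z /\
       (w z ^ 2)%C = f z).

(* The integral of [f] along the straight segment from [a] to [b] is [I].
   It is improper at both ends, since the integrand need not be defined there
   (here it blows up like (s - 1)^(-1/2) at s = 1). *)
Definition is_segment_integral (f : C -> C) (a b I : C) : Prop :=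
  is_RInt_gen (V := C_R_NormedModule)
    (fun t : R => (f (segment a b t) * (b - a))%C)
    (at_right 0) (at_left 1) I.

(* Two branches on the segment differ by a sign, so that the choice of [w] is
   immaterial. *)
Definition re_integral_vanishes (lambda x : R) : Prop :=
  exists (w : C -> C) (I : C),
    sqrt_branch (Q lambda x) (z_pt lambda x) (RtoC 1) w /\
    is_segment_integral w (z_pt lambda x) (RtoC 1) I /\
    Re I = 0.

(* Main.v *)
Require Import Defs.
From Stdlib Require Import Reals Ranalysis5 Lra.
From Coquelicot Require Import Coquelicot.
Open Scope R_scope.

(** Put [b = 2 / lambda], [p = x + i b], [l = 1 - p = 1 - x - i b] and
    parametrise the segment by [s = p + t l], [0 < t < 1].  Then
    [Q (s) = (1 / b ^ 2) (t / (1 - t)) R (t)] with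
    [R (t) = (2 x + t l) / (2 - (1 - t) l)].  For [0 < x < 1] the values of [R]
    lie in the open lower half-plane, so that a single square root [csqrt],
    with values in the fourth quadrant, gives a branch along the whole
    segment, and every other branch is plus or minus this one.  The
    substitution [t = sin ^ 2 th] removes the endpoint singularities, and the
    integral of the theorem has real part [+- period b x / b], where
    [period b x = int_0^{pi/2} 2 sin ^ 2 th Re (l G (sin ^ 2 th)) dth] and
    [G = csqrt R] ([re_integral_vanishes_iff]).  It remains to study the real
    function [period b] on [(0, 1)].

    Monotonicity ([period_decreasing]).  Moving the endpoint of the path moves
    the whole segment, and the [x]-derivative of the integrand has no
    constant sign.  However it differs from the integrand of
    [d/dx int sqrt Q ds = int d/dx (sqrt Q) ds], taken along the fixed path,
    by the derivative of [sin th cos th G], which vanishes at both ends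
    ([is_derive_integrand]).  What is left is [- 2 x Re (1 / (G den))], where
    [den = 2 - (1 - t) l].  As [G] is in the open fourth and [den] in the
    closed first quadrant, [G den] has positive real part, and the derivative
    of [period b] is negative.

    Existence.  At [x = 0] the function [b sqrt Q] has the elementary
    antiderivative [i sqrt (s ^ 2 - 1) + b log (s + sqrt (s ^ 2 - 1))], whence
    [period b 0 = sqrt (1 + b ^ 2) - b ln (b + sqrt (1 + b ^ 2))]
    ([period_0]).  This is positive exactly when [lambda > lambda_c], and
    positivity persists for small [x > 0] by continuity.  Near [x = 1] the path
    is almost vertical, and the integrand itself is negative
    ([period_neg_near_1]); the intermediate value theorem applies.

    Limit.  For fixed [x < 1] and small [b] the path is almost horizontal and
    the integrand is positive ([period_gt_0]); by monotonicity the zero lies to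
    the right of [x]. *)

(** * Complex-valued functions, by components *)

Definition is_Cderive (f : R -> C) (x : R) (l : C) : Prop :=
  is_derive (fun y => Re (f y)) x (Re l) /\
  is_derive (fun y => Im (f y)) x (Im l).

Definition Ccontinuous {T : UniformSpace} (f : T -> C) (p : T) : Prop :=
  continuous (fun q => Re (f q)) p /\ continuous (fun q => Im (f q)) p.

Lemma C_ext (z w : C) : Re z = Re w -> Im z = Im w -> z = w.
Proof. destruct z, w; simpl; intros -> ->; reflexivity. Qed.

Lemma C_norm2_gt_0 (z : C) : z <> RtoC 0 -> 0 < Re z * Re z + Im z * Im z.
Proof.
intros Hz.
destruct (Req_dec (Re z) 0) as [Hr | Hr]; [|nra].
destruct (Req_dec (Im z) 0) as [Hi | Hi]; [|nra].
exfalso; apply Hz, C_ext; assumption.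
Qed.

Lemma C_Re_neq_0 (z : C) : Re z <> 0 -> z <> RtoC 0.
Proof. intros H E; apply H; rewrite E; reflexivity. Qed.

Lemma C_Im_neq_0 (z : C) : Im z <> 0 -> z <> RtoC 0.
Proof. intros H E; apply H; rewrite E; reflexivity. Qed.

Lemma is_derive_eq (f : R -> R) (x l l' : R) :
  is_derive f x l -> l = l' -> is_derive f x l'.
Proof. intros H <-; exact H. Qed.

Lemma is_Cderive_const (c : C) (x : R) : is_Cderive (fun _ => c) x (RtoC 0).
Proof. split; apply @is_derive_const. Qed.

Lemma is_Cderive_RtoC (f : R -> R) (x l : R) :
  is_derive f x l -> is_Cderive (fun y => RtoC (f y)) x (RtoC l).
Proof.
intros H; split; [exact H|].
exact (is_derive_const (K := R_AbsRing) (V := R_NormedModule) 0 x).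
Qed.

Lemma is_Cderive_eq (f : R -> C) (x : R) (l l' : C) :
  is_Cderive f x l -> l = l' -> is_Cderive f x l'.
Proof. intros H <-; exact H. Qed.

Lemma is_Cderive_plus (f g : R -> C) (x : R) (lf lg : C) :
  is_Cderive f x lf -> is_Cderive g x lg ->
  is_Cderive (fun y => (f y + g y)%C) x (lf + lg)%C.
Proof.
intros [Fr Fi] [Gr Gi]; split.
- exact (is_derive_plus (K := R_AbsRing) (V := R_NormedModule) _ _ _ _ _ Fr Gr).
- exact (is_derive_plus (K := R_AbsRing) (V := R_NormedModule) _ _ _ _ _ Fi Gi).
Qed.

Lemma is_derive_Rmult (f g : R -> R) (x lf lg : R) :
  is_derive f x lf -> is_derive g x lg ->
  is_derive (fun y => f y * g y) x (lf * g x + f x * lg).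
Proof. intros Hf Hg; exact (is_derive_mult f g x lf lg Hf Hg Rmult_comm). Qed.

Lemma is_Cderive_mult (f g : R -> C) (x : R) (lf lg : C) :
  is_Cderive f x lf -> is_Cderive g x lg ->
  is_Cderive (fun y => (f y * g y)%C) x (lf * g x + f x * lg)%C.
Proof.
intros [Fr Fi] [Gr Gi]; split.
- replace (Re _) with ((Re lf * Re (g x) + Re (f x) * Re lg) -
    (Im lf * Im (g x) + Im (f x) * Im lg)) by (unfold Re, Im; simpl; ring).
  exact (is_derive_minus (K := R_AbsRing) (V := R_NormedModule) _ _ _ _ _
    (is_derive_Rmult _ _ _ _ _ Fr Gr) (is_derive_Rmult _ _ _ _ _ Fi Gi)).
- replace (Im _) with ((Re lf * Im (g x) + Re (f x) * Im lg) +
    (Im lf * Re (g x) + Im (f x) * Re lg)) by (unfold Re, Im; simpl; ring).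
  exact (is_derive_plus (K := R_AbsRing) (V := R_NormedModule) _ _ _ _ _
    (is_derive_Rmult _ _ _ _ _ Fr Gi) (is_derive_Rmult _ _ _ _ _ Fi Gr)).
Qed.

Lemma is_derive_div_norm2 (u v w : R -> R) (x lu lv lw : R) :
  0 < v x ^ 2 + w x ^ 2 ->
  is_derive u x lu -> is_derive v x lv -> is_derive w x lw ->
  is_derive (fun y => u y / (v y ^ 2 + w y ^ 2)) x
    ((lu * (v x ^ 2 + w x ^ 2) - u x * (2 * v x * lv + 2 * w x * lw)) /
     (v x ^ 2 + w x ^ 2) ^ 2).
Proof.
intros P Hu Hv Hw.
auto_derive; [repeat split; try (eexists; eassumption); simpl in P; lra|].
rewrite (is_derive_unique (fun y : R => u y) _ _ Hu),
  (is_derive_unique (fun y : R => v y) _ _ Hv),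
  (is_derive_unique (fun y : R => w y) _ _ Hw).
field; simpl in *; lra.
Qed.

Lemma is_Cderive_inv (f : R -> C) (x : R) (l : C) :
  f x <> RtoC 0 -> is_Cderive f x l ->
  is_Cderive (fun y => (/ f y)%C) x (- l / (f x * f x))%C.
Proof.
intros Hf [Fr Fi].
pose proof (C_norm2_gt_0 _ Hf) as Hn.
assert (P : 0 < Re (f x) ^ 2 + Im (f x) ^ 2) by nra.
assert (E : forall a c : R, 0 < a ^ 2 + c ^ 2 ->
  (a * a - c * c) ^ 2 + (a * c + c * a) ^ 2 <> 0).
{ intros a c H.
  replace (_ + _) with ((a ^ 2 + c ^ 2) ^ 2) by ring.
  apply pow_nonzero; lra. }
pose proof (E _ _ P) as E'.
assert (Fo := is_derive_opp (K := R_AbsRing) (V := R_NormedModule) _ _ _ Fi).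
split.
- eapply is_derive_eq;
    [exact (is_derive_div_norm2 _ _ _ _ _ _ _ P Fr Fr Fi)|].
  unfold Re, Im in *; simpl in *; field; split; lra.
- eapply is_derive_eq;
    [exact (is_derive_div_norm2 _ _ _ _ _ _ _ P Fo Fr Fi)|].
  unfold Re, Im, opp in *; simpl in *; field; split; lra.
Qed.

Lemma is_Cderive_div (f g : R -> C) (x : R) (lf lg : C) :
  g x <> RtoC 0 -> is_Cderive f x lf -> is_Cderive g x lg ->
  is_Cderive (fun y => (f y / g y)%C) x
    ((lf * g x - f x * lg) / (g x * g x))%C.
Proof.
intros Hg Hf Hd.
eapply is_Cderive_eq.
- apply (is_Cderive_mult f (fun y => / g y)%C); [exact Hf|].
  apply is_Cderive_inv; eassumption.
- field; exact Hg.
Qed.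

Lemma continuous_Rmult {T : UniformSpace} (f g : T -> R) (p : T) :
  continuous f p -> continuous g p -> continuous (fun q => f q * g q) p.
Proof. exact (@continuous_mult T R_AbsRing f g p). Qed.

Lemma continuous_Rplus {T : UniformSpace} (f g : T -> R) (p : T) :
  continuous f p -> continuous g p -> continuous (fun q => f q + g q) p.
Proof. exact (@continuous_plus T R_AbsRing R_NormedModule f g p). Qed.

Lemma continuous_Rminus {T : UniformSpace} (f g : T -> R) (p : T) :
  continuous f p -> continuous g p -> continuous (fun q => f q - g q) p.
Proof. exact (@continuous_minus T R_AbsRing R_NormedModule f g p). Qed.

Lemma continuous_Ropp {T : UniformSpace} (f : T -> R) (p : T) :
  continuous f p -> continuous (fun q => - f q) p.
Proof. exact (@continuous_opp T R_AbsRing R_NormedModule f p). Qed.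

Lemma continuous_Rdiv {T : UniformSpace} (f g : T -> R) (p : T) :
  g p <> 0 -> continuous f p -> continuous g p ->
  continuous (fun q => f q / g q) p.
Proof.
intros H Hf Hg; apply continuous_Rmult; [exact Hf|].
apply (continuous_comp g Rinv); [exact Hg|].
apply continuous_Rinv, H.
Qed.

Lemma continuous_Rsqrt {T : UniformSpace} (f : T -> R) (p : T) :
  continuous f p -> continuous (fun q => sqrt (f q)) p.
Proof.
intros Hf; apply (continuous_comp f sqrt); [exact Hf|apply continuous_sqrt].
Qed.

Lemma Ccontinuous_plus {T : UniformSpace} (f g : T -> C) (p : T) :
  Ccontinuous f p -> Ccontinuous g p -> Ccontinuous (fun q => (f q + g q)%C) p.
Proof.
intros [Fr Fi] [Gr Gi]; split.
- apply (continuous_Rplus (fun q => Re (f q)) (fun q => Re (g q))); assumption.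
- apply (continuous_Rplus (fun q => Im (f q)) (fun q => Im (g q))); assumption.
Qed.

Lemma Ccontinuous_opp {T : UniformSpace} (f : T -> C) (p : T) :
  Ccontinuous f p -> Ccontinuous (fun q => (- f q)%C) p.
Proof.
intros [Fr Fi]; split.
- apply (continuous_Ropp (fun q => Re (f q))); assumption.
- apply (continuous_Ropp (fun q => Im (f q))); assumption.
Qed.

Lemma Ccontinuous_mult {T : UniformSpace} (f g : T -> C) (p : T) :
  Ccontinuous f p -> Ccontinuous g p -> Ccontinuous (fun q => (f q * g q)%C) p.
Proof.
intros [Fr Fi] [Gr Gi]; split.
- apply (continuous_Rminus (fun q => Re (f q) * Re (g q))
    (fun q => Im (f q) * Im (g q))); apply continuous_Rmult; assumption.
- apply (continuous_Rplus (fun q => Re (f q) * Im (g q))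
    (fun q => Im (f q) * Re (g q))); apply continuous_Rmult; assumption.
Qed.

Lemma Ccontinuous_inv {T : UniformSpace} (f : T -> C) (p : T) :
  f p <> RtoC 0 -> Ccontinuous f p -> Ccontinuous (fun q => (/ f q)%C) p.
Proof.
intros Hf [Fr Fi].
pose proof (C_norm2_gt_0 _ Hf) as Hn; unfold Re, Im in Hn.
assert (D : continuous (fun q => fst (f q) ^ 2 + snd (f q) ^ 2) p).
{ apply (continuous_ext
    (fun q => Re (f q) * Re (f q) + Im (f q) * Im (f q))).
  { intros q; unfold Re, Im; simpl; ring. }
  apply continuous_Rplus; apply continuous_Rmult; assumption. }
split; simpl; apply continuous_Rdiv; try assumption; simpl; try lra.
apply continuous_Ropp; assumption.
Qed.

Lemma Ccontinuous_div {T : UniformSpace} (f g : T -> C) (p : T) :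
  g p <> RtoC 0 -> Ccontinuous f p -> Ccontinuous g p ->
  Ccontinuous (fun q => (f q / g q)%C) p.
Proof.
intros Hg Hf H; apply Ccontinuous_mult; [exact Hf|].
apply Ccontinuous_inv; assumption.
Qed.

Lemma Ccontinuous_RtoC {T : UniformSpace} (f : T -> R) (p : T) :
  continuous f p -> Ccontinuous (fun q => RtoC (f q)) p.
Proof. intros Hf; split; [exact Hf|apply continuous_const]. Qed.

(** * The square root on the lower half-plane *)

(** The branch with values in the closed fourth quadrant, in closed form from
    [Re w ^ 2 + Im w ^ 2 = Cmod z] and [Re w ^ 2 - Im w ^ 2 = Re z].  The
    formula is continuous on the whole plane, but squares to [z] only when
    [Im z <= 0]. *)
Definition csqrt (z : C) : C :=
  (sqrt ((Cmod z + Re z) / 2), - sqrt ((Cmod z - Re z) / 2)).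

Lemma csqrt_args (z : C) : 0 <= (Cmod z + Re z) / 2 /\ 0 <= (Cmod z - Re z) / 2.
Proof.
pose proof (re_le_Cmod z) as H; pose proof (Rle_abs (Re z)).
pose proof (Rle_abs (- Re z)) as K; rewrite Rabs_Ropp in K.
split; lra.
Qed.

Lemma Cmod_sqr_Re_Im (z : C) : Cmod z * Cmod z = Re z * Re z + Im z * Im z.
Proof.
unfold Cmod, Re, Im; rewrite sqrt_sqrt; [ring|].
pose proof (pow2_ge_0 (fst z)); pose proof (pow2_ge_0 (snd z)); lra.
Qed.

Lemma csqrt_Re_ge_0 (z : C) : 0 <= Re (csqrt z).
Proof. apply sqrt_pos. Qed.

Lemma csqrt_Im_le_0 (z : C) : Im (csqrt z) <= 0.
Proof.
unfold csqrt; simpl; pose proof (sqrt_pos ((Cmod z - Re z) / 2)); lra.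
Qed.

Lemma csqrt_spec (z : C) : Im z <= 0 -> (csqrt z * csqrt z)%C = z.
Proof.
intros Hz; destruct (csqrt_args z) as [A B].
unfold csqrt; apply C_ext; simpl.
- rewrite Rmult_opp_opp, !sqrt_sqrt by assumption; field.
- replace (_ + _) with
    (- (2 * (sqrt ((Cmod z + Re z) / 2) * sqrt ((Cmod z - Re z) / 2)))) by ring.
  rewrite <- sqrt_mult by assumption.
  replace (_ / 2 * _) with ((- (Im z / 2))²).
  + rewrite sqrt_Rsqr by lra; lra.
  + pose proof (Cmod_sqr_Re_Im z); unfold Rsqr; lra.
Qed.

Lemma csqrt_Cmod (z : C) : Re (csqrt z) ^ 2 + Im (csqrt z) ^ 2 = Cmod z.
Proof.
destruct (csqrt_args z) as [A B]; unfold csqrt; simpl.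
rewrite !Rmult_1_r, Rmult_opp_opp, !sqrt_sqrt by assumption; lra.
Qed.

Lemma csqrt_lower (z : C) : Im z < 0 -> 0 < Re (csqrt z) /\ Im (csqrt z) < 0.
Proof.
intros Hz.
pose proof (csqrt_Re_ge_0 z) as A; pose proof (csqrt_Im_le_0 z) as B.
pose proof (f_equal Im (csqrt_spec z (Rlt_le _ _ Hz))) as E.
set (g := csqrt z) in *; clearbody g.
unfold Re, Im in *; simpl in *; split; nra.
Qed.

Lemma csqrt_neq_0 (z : C) : Im z < 0 -> csqrt z <> RtoC 0.
Proof. intros H; apply C_Re_neq_0; apply csqrt_lower in H; lra. Qed.

Lemma is_derive_norm (u v : R -> R) (x lu lv : R) :
  0 < u x ^ 2 + v x ^ 2 -> is_derive u x lu -> is_derive v x lv ->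
  is_derive (fun y => sqrt (u y ^ 2 + v y ^ 2)) x
    ((u x * lu + v x * lv) / sqrt (u x ^ 2 + v x ^ 2)).
Proof.
intros P Hu Hv.
pose proof (sqrt_lt_R0 _ P).
auto_derive; [repeat split; try (eexists; eassumption); simpl in P; lra|].
rewrite (is_derive_unique (fun y : R => u y) _ _ Hu),
  (is_derive_unique (fun y : R => v y) _ _ Hv).
simpl in *; field; lra.
Qed.

Lemma is_derive_sqrt_half (u : R -> R) (x l : R) :
  0 < u x / 2 -> is_derive u x l ->
  is_derive (fun y => sqrt (u y / 2)) x (l / (4 * sqrt (u x / 2))).
Proof.
intros P Hu.
pose proof (sqrt_lt_R0 _ P).
auto_derive; [repeat split; try (eexists; eassumption); lra|].
rewrite (is_derive_unique (fun y : R => u y) _ _ Hu).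
change (u x / 2) with (u x * / 2) in *.
field; lra.
Qed.

(** Both components of [csqrt] are square roots of real functions that are
    positive when [Im (f x) < 0]; on the real axis one of them degenerates. *)
Lemma is_Cderive_csqrt (f : R -> C) (x : R) (l : C) :
  Im (f x) < 0 -> is_Cderive f x l ->
  is_Cderive (fun y => csqrt (f y)) x (l / (RtoC 2 * csqrt (f x)))%C.
Proof.
intros Hf [Fr Fi].
destruct (csqrt_lower _ Hf) as [Hr Hi].
pose proof (csqrt_Cmod (f x)) as HM.
pose proof (csqrt_spec _ (Rlt_le _ _ Hf)) as E.
assert (P1 : 0 < (Cmod (f x) + Re (f x)) / 2).
{ apply sqrt_lt_0_alt; rewrite sqrt_0; exact Hr. }
assert (P2 : 0 < (Cmod (f x) - Re (f x)) / 2).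
{ apply sqrt_lt_0_alt; rewrite sqrt_0; simpl in Hi; lra. }
assert (P0 : 0 < Re (f x) ^ 2 + Im (f x) ^ 2) by nra.
assert (Er := f_equal Re E); assert (Ei := f_equal Im E).
set (m := (Re (f x) * Re l + Im (f x) * Im l) / Cmod (f x)).
assert (M : is_derive (fun y => Cmod (f y)) x m)
  by exact (is_derive_norm (fun y => Re (f y)) (fun y => Im (f y))
    _ _ _ P0 Fr Fi).
assert (A : is_derive (fun y => Cmod (f y) + Re (f y)) x (m + Re l))
  by exact (is_derive_plus (K := R_AbsRing) (V := R_NormedModule)
    _ _ _ _ _ M Fr).
assert (B : is_derive (fun y => Cmod (f y) - Re (f y)) x (m - Re l))
  by exact (is_derive_minus (K := R_AbsRing) (V := R_NormedModule)
    _ _ _ _ _ M Fr).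
unfold m in A, B; clear M m.
assert (A' := is_derive_sqrt_half (fun y => Cmod (f y) + Re (f y)) _ _ P1 A).
assert (B' := is_derive_opp (K := R_AbsRing) (V := R_NormedModule) _ _ _
  (is_derive_sqrt_half (fun y => Cmod (f y) - Re (f y)) _ _ P2 B)).
split.
- eapply is_derive_eq; [exact A'|].
  change (sqrt _) with (Re (csqrt (f x))).
  set (g := csqrt (f x)) in *.
  rewrite <- Er, <- Ei, <- HM.
  unfold Re, Im, plus, minus, opp in *; simpl in *.
  field; repeat split; nra.
- eapply is_derive_eq; [exact B'|].
  replace (sqrt _) with (- Im (csqrt (f x)))
    by (unfold csqrt; simpl; rewrite Ropp_involutive; reflexivity).
  set (g := csqrt (f x)) in *.
  rewrite <- Er, <- Ei, <- HM.
  unfold Re, Im, plus, minus, opp in *; simpl in *.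
  field; repeat split; nra.
Qed.

Lemma Ccontinuous_csqrt {T : UniformSpace} (f : T -> C) (p : T) :
  Ccontinuous f p -> Ccontinuous (fun q => csqrt (f q)) p.
Proof.
intros [Fr Fi].
assert (M : continuous (fun q => Cmod (f q)) p).
{ unfold Cmod; apply continuous_Rsqrt.
  apply (continuous_ext
    (fun q => Re (f q) * Re (f q) + Im (f q) * Im (f q))).
  { intros q; unfold Re, Im; simpl; ring. }
  apply continuous_Rplus; apply continuous_Rmult; assumption. }
split; simpl.
- apply continuous_Rsqrt, continuous_Rmult; [|apply continuous_const].
  apply continuous_Rplus; assumption.
- apply continuous_Ropp, continuous_Rsqrt, continuous_Rmult;
    [|apply continuous_const].
  apply continuous_Rminus; assumption.
Qed.

(** Two roots in the same quadrant do not cancel; this bounds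
    [csqrt y - csqrt z = (y - z) / (csqrt y + csqrt z)] when [csqrt] is
    differentiated. *)
Lemma csqrt_sum_ge (z w : C) :
  Cmod z <= Re (csqrt z + csqrt w)%C ^ 2 + Im (csqrt z + csqrt w)%C ^ 2.
Proof.
rewrite <- csqrt_Cmod.
pose proof (csqrt_Re_ge_0 z); pose proof (csqrt_Im_le_0 z).
pose proof (csqrt_Re_ge_0 w); pose proof (csqrt_Im_le_0 w).
change (Re (csqrt z + csqrt w)%C) with (Re (csqrt z) + Re (csqrt w)).
change (Im (csqrt z + csqrt w)%C) with (Im (csqrt z) + Im (csqrt w)).
nra.
Qed.

(** * The integrand on the segment *)

(** [leg] is the vector [1 - z_pt] of the segment.  At the point [s] with
    parameter [t], [num] is [s + conj z_pt] and [den] is [s + 1]; these are the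
    factors of [Q] which stay away from zero when [0 < x]. *)
Definition leg (b x : R) : C := (1 - x, - b).
Definition num (b x t : R) : C := (2 * x + t * (1 - x), - (t * b)).
Definition den (b x t : R) : C := (1 + x + t * (1 - x), (1 - t) * b).
Definition ratio (b x t : R) : C := (num b x t / den b x t)%C.
Definition root (b x t : R) : C := csqrt (ratio b x t).
Definition integrand (b x th : R) : R :=
  2 * sin th ^ 2 * Re (leg b x * root b x (sin th ^ 2))%C.
Definition period (b x : R) : R := RInt (integrand b x) 0 (PI / 2).

Lemma num_leg (b x t : R) : num b x t = (RtoC (2 * x) + RtoC t * leg b x)%C.
Proof. apply C_ext; unfold num, leg; simpl; ring. Qed.

Lemma den_leg (b x t : R) : den b x t = (RtoC 2 - RtoC (1 - t) * leg b x)%C.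
Proof. apply C_ext; unfold den, leg; simpl; ring. Qed.

Lemma sin2_bounds (th : R) : 0 <= sin th ^ 2 <= 1.
Proof.
pose proof (sin2_cos2 th) as H; unfold Rsqr in H.
pose proof (pow2_ge_0 (cos th)); pose proof (pow2_ge_0 (sin th)); simpl in *; lra.
Qed.

Lemma den_Re_ge_1 (b x t : R) : 0 <= x <= 1 -> 0 <= t -> 1 <= Re (den b x t).
Proof. intros Hx Ht; unfold den; simpl; nra. Qed.

Lemma den_neq_0 (b x t : R) : 0 <= x <= 1 -> 0 <= t -> den b x t <> RtoC 0.
Proof.
intros Hx Ht; apply C_Re_neq_0; pose proof (den_Re_ge_1 b x t Hx Ht); lra.
Qed.

Lemma den_norm2_gt_0 (b x t : R) : 0 <= x <= 1 -> 0 <= t ->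
  0 < Re (den b x t) ^ 2 + Im (den b x t) ^ 2.
Proof. intros Hx Ht; pose proof (den_Re_ge_1 b x t Hx Ht); nra. Qed.

Lemma ratio_Re (b x t : R) : 0 <= x <= 1 -> 0 <= t ->
  Re (ratio b x t) =
  ((2 * x + t * (1 - x)) * (1 + x + t * (1 - x)) - t * (1 - t) * b ^ 2) /
  (Re (den b x t) ^ 2 + Im (den b x t) ^ 2).
Proof.
intros Hx Ht; pose proof (den_norm2_gt_0 b x t Hx Ht) as H.
unfold ratio, den, num, Re, Im in *; simpl in *; field; lra.
Qed.

(** The imaginary part of [num * conj den] collapses to a product of constant
    sign, which is what allows one branch [csqrt] for the whole segment. *)
Lemma ratio_Im (b x t : R) : 0 <= x <= 1 -> 0 <= t ->
  Im (ratio b x t) =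
  - (2 * b * (x + t * (1 - x))) /
  (Re (den b x t) ^ 2 + Im (den b x t) ^ 2).
Proof.
intros Hx Ht; pose proof (den_norm2_gt_0 b x t Hx Ht) as H.
unfold ratio, den, num, Re, Im in *; simpl in *; field; lra.
Qed.

Lemma ratio_Im_lt_0 (b x t : R) : 0 < b -> 0 <= x <= 1 -> 0 <= t <= 1 ->
  0 < x + t -> Im (ratio b x t) < 0.
Proof.
intros Hb Hx Ht Hxt; rewrite ratio_Im by lra.
pose proof (den_norm2_gt_0 b x t Hx (proj1 Ht)) as H.
unfold Rdiv; rewrite Ropp_mult_distr_l_reverse; apply Ropp_lt_gt_0_contravar.
apply Rmult_lt_0_compat; [|apply Rinv_0_lt_compat, H].
apply Rmult_lt_0_compat; [lra|].
nra.
Qed.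

Lemma ratio_Im_le_0 (b x t : R) : 0 < b -> 0 <= x <= 1 -> 0 <= t <= 1 ->
  Im (ratio b x t) <= 0.
Proof.
intros Hb Hx Ht.
destruct (Req_dec (x + t) 0) as [E | E].
- rewrite ratio_Im by lra; replace x with 0 by lra; replace t with 0 by lra.
  unfold Rdiv; apply Req_le; ring.
- apply Rlt_le, ratio_Im_lt_0; lra.
Qed.

Lemma Ccontinuous_leg {T : UniformSpace} (b : R) (u : T -> R) (p : T) :
  continuous u p -> Ccontinuous (fun q => leg b (u q)) p.
Proof.
intros Hu; split; simpl; [|apply continuous_const].
apply continuous_Rminus; [apply continuous_const|exact Hu].
Qed.

Lemma Ccontinuous_num {T : UniformSpace} (b : R) (u v : T -> R) (p : T) :
  continuous u p -> continuous v p ->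
  Ccontinuous (fun q => num b (u q) (v q)) p.
Proof.
intros Hu Hv.
assert (Hw : continuous (fun q => v q * (1 - u q)) p).
{ apply continuous_Rmult; [exact Hv|].
  apply continuous_Rminus; [apply continuous_const|exact Hu]. }
split; simpl.
- apply continuous_Rplus; [|exact Hw].
  apply continuous_Rmult; [apply continuous_const|exact Hu].
- apply continuous_Ropp, continuous_Rmult; [exact Hv|apply continuous_const].
Qed.

Lemma Ccontinuous_den {T : UniformSpace} (b : R) (u v : T -> R) (p : T) :
  continuous u p -> continuous v p ->
  Ccontinuous (fun q => den b (u q) (v q)) p.
Proof.
intros Hu Hv.
assert (Hw : continuous (fun q => v q * (1 - u q)) p).
{ apply continuous_Rmult; [exact Hv|].
  apply continuous_Rminus; [apply continuous_const|exact Hu]. }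
split; simpl.
- apply continuous_Rplus; [|exact Hw].
  apply continuous_Rplus; [apply continuous_const|exact Hu].
- apply continuous_Rmult; [|apply continuous_const].
  apply continuous_Rminus; [apply continuous_const|exact Hv].
Qed.

Lemma Ccontinuous_root {T : UniformSpace} (b : R) (u v : T -> R) (p : T) :
  0 <= u p <= 1 -> 0 <= v p -> continuous u p -> continuous v p ->
  Ccontinuous (fun q => root b (u q) (v q)) p.
Proof.
intros Bu Bv Hu Hv; apply Ccontinuous_csqrt, Ccontinuous_div.
- apply den_neq_0; assumption.
- apply Ccontinuous_num; assumption.
- apply Ccontinuous_den; assumption.
Qed.

Lemma continuous_sin2 {T : UniformSpace} (v : T -> R) (p : T) :
  continuous v p -> continuous (fun q => sin (v q) ^ 2) p.
Proof.
intros Hv.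
assert (H : continuous (fun q => sin (v q)) p).
{ apply (continuous_comp v sin); [exact Hv|apply continuous_sin]. }
apply (continuous_ext (fun q => sin (v q) * sin (v q))); [intros q; simpl; ring|].
apply continuous_Rmult; exact H.
Qed.

Lemma continuous_integrand (b x th : R) : 0 <= x <= 1 ->
  continuous (integrand b x) th.
Proof.
intros Hx; apply continuous_Rmult.
- apply continuous_Rmult; [apply continuous_const|].
  apply continuous_sin2, continuous_id.
- refine (proj1 (Ccontinuous_mult (fun _ => leg b x)
    (fun q => root b x (sin q ^ 2)) th _ _)).
  + apply Ccontinuous_leg, continuous_const.
  + apply (Ccontinuous_root b (fun _ => x) (fun q => sin q ^ 2)).
    * exact Hx.
    * apply sin2_bounds.
    * apply continuous_const.
    * apply (continuous_sin2 (fun q => q)), continuous_id.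
Qed.

Lemma ex_RInt_integrand (b x a c : R) : 0 <= x <= 1 ->
  ex_RInt (integrand b x) a c.
Proof.
intros Hx; apply (ex_RInt_continuous (V := R_CompleteNormedModule)).
intros th _; apply continuous_integrand, Hx.
Qed.

(** * Monotonicity in the endpoint *)

(** Stated along curves [u], [v], so that it serves for the derivative in [x]
    and for the derivative in [th]. *)
Lemma is_Cderive_root (b : R) (u v : R -> R) (x : R) (ln ld : C) :
  0 < b -> 0 < u x < 1 -> 0 <= v x <= 1 ->
  is_Cderive (fun y => num b (u y) (v y)) x ln ->
  is_Cderive (fun y => den b (u y) (v y)) x ld ->
  is_Cderive (fun y => root b (u y) (v y)) x
    ((ln * den b (u x) (v x) - num b (u x) (v x) * ld) /
     (RtoC 2 * root b (u x) (v x) * (den b (u x) (v x) * den b (u x) (v x))))%C.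
Proof.
intros Hb Hu Hv Hn Hd.
assert (D : den b (u x) (v x) <> RtoC 0) by (apply den_neq_0; lra).
assert (I : Im (ratio b (u x) (v x)) < 0) by (apply ratio_Im_lt_0; lra).
assert (A := csqrt_neq_0 _ I).
eapply is_Cderive_eq.
- apply (is_Cderive_csqrt (fun y => ratio b (u y) (v y))); [exact I|].
  apply (is_Cderive_div (fun y => num b (u y) (v y))
    (fun y => den b (u y) (v y))); eassumption.
- cbv beta; unfold root.
  generalize dependent (csqrt (ratio b (u x) (v x))).
  generalize dependent (den b (u x) (v x)).
  intros; field; split; assumption.
Qed.

(** [bulk] is the real part of [b * d/dx (sqrt Q) * ds/dth], the derivative in
    [x] being taken at a fixed point [s]; [edge] is the flux [b * sqrt Q * ds/dx]
    with [ds/dx = 1 - t], and [edge'] its derivative in [th] as a function of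
    [t = sin ^ 2 th]. *)
Definition bulk (b x t : R) : R :=
  - (2 * x) * Re (/ (root b x t * den b x t))%C.
Definition edge (b x th : R) : C :=
  (RtoC (sin th * cos th) * root b x (sin th ^ 2))%C.
Definition edge' (b x t : R) : C :=
  (RtoC (1 - 2 * t) * root b x t + RtoC (t * (1 - t)) * leg b x *
   (den b x t - num b x t) / (root b x t * (den b x t * den b x t)))%C.

Lemma root_sqr (b x t : R) : 0 < b -> 0 <= x <= 1 -> 0 <= t <= 1 ->
  (root b x t * root b x t * den b x t)%C = num b x t.
Proof.
intros Hb Hx Ht; unfold root.
rewrite csqrt_spec by (apply ratio_Im_le_0; assumption).
unfold ratio; field; apply den_neq_0; lra.
Qed.

Lemma root_neq_0 (b x t : R) : 0 < b -> 0 < x < 1 -> 0 <= t <= 1 ->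
  root b x t <> RtoC 0.
Proof. intros Hb Hx Ht; apply csqrt_neq_0, ratio_Im_lt_0; lra. Qed.

Lemma edge_algebra (c k l n d r : C) : d <> RtoC 0 -> r <> RtoC 0 ->
  (c * r + k * ((RtoC 2 * k * l * d - n * (RtoC 2 * k * l)) /
    (RtoC 2 * r * (d * d))) =
   c * r + k * k * l * (d - n) / (r * (d * d)))%C.
Proof. intros; field; split; assumption. Qed.

(** The complex identity [d/dx (2 t l G) = - 2 x / (G d) + d/dth edge], after the
    chain rule for [G = csqrt (n / d)].  The relation [G ^ 2 d = n] turns
    every term into [1 / G] times a rational function of [x], [t], [l]. *)
Lemma bulk_edge_algebra (x t l n d r : C) : d <> RtoC 0 -> r <> RtoC 0 ->
  n = (RtoC 2 * x + t * l)%C -> d = (RtoC 2 - (RtoC 1 - t) * l)%C ->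
  (r * r * d)%C = n ->
  (RtoC 2 * t * (- r + l * (((RtoC 2 - t) * d - n * (RtoC 1 - t)) /
     (RtoC 2 * r * (d * d)))) =
   - (RtoC 2 * x) * / (r * d) +
   ((RtoC 1 - RtoC 2 * t) * r +
    t * (RtoC 1 - t) * l * (d - n) / (r * (d * d))))%C.
Proof.
intros Hd Hr En Ed Er.
assert (E : forall q : C, q = r ->
  (RtoC 2 * t * (- q + l * (((RtoC 2 - t) * d - n * (RtoC 1 - t)) /
     (RtoC 2 * r * (d * d)))) =
   - (RtoC 2 * x) * / (r * d) +
   ((RtoC 1 - RtoC 2 * t) * q +
    t * (RtoC 1 - t) * l * (d - n) / (r * (d * d))))%C).
2: { apply E; reflexivity. }
intros q Eq.
assert (Eq' : q = (n / (r * d))%C).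
{ rewrite Eq, <- Er; field; split; assumption. }
rewrite Eq'.
transitivity
  (t * (- (RtoC 2) * n * d + l * ((RtoC 2 - t) * d - n * (RtoC 1 - t))) /
    (r * (d * d)))%C; [field; split; assumption|].
transitivity
  ((- (RtoC 2) * x * d + (RtoC 1 - RtoC 2 * t) * n * d +
    t * (RtoC 1 - t) * l * (d - n)) / (r * (d * d)))%C;
  [|field; split; assumption].
f_equal; rewrite En, Ed; ring.
Qed.

Lemma is_derive_edge (b x th : R) : 0 < b -> 0 < x < 1 ->
  is_Cderive (edge b x) th (edge' b x (sin th ^ 2)).
Proof.
intros Hb Hx.
pose proof (sin2_bounds th) as St.
assert (D : den b x (sin th ^ 2) <> RtoC 0) by (apply den_neq_0; lra).
pose proof (root_neq_0 b x _ Hb Hx St) as N.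
assert (K : is_Cderive (fun y => RtoC (sin y * cos y)) th
  (RtoC (1 - 2 * sin th ^ 2))).
{ apply is_Cderive_RtoC.
  auto_derive; [exact I|].
  pose proof (sin2_cos2 th) as H; unfold Rsqr in H; lra. }
set (l := (RtoC 2 * RtoC (sin th * cos th) * leg b x)%C).
assert (Ln : is_Cderive (fun y => num b x (sin y ^ 2)) th l).
{ split; simpl; auto_derive; try exact I; ring. }
assert (Ld : is_Cderive (fun y => den b x (sin y ^ 2)) th l).
{ split; simpl; auto_derive; try exact I; ring. }
eapply is_Cderive_eq.
- exact (is_Cderive_mult _ _ _ _ _ K
    (is_Cderive_root b (fun _ => x) (fun y => sin y ^ 2) th _ _ Hb Hx St Ln Ld)).
- unfold edge'.
  replace (RtoC (sin th ^ 2 * (1 - sin th ^ 2))) with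
    (RtoC (sin th * cos th) * RtoC (sin th * cos th))%C.
  + apply edge_algebra; assumption.
  + rewrite <- RtoC_mult; f_equal.
    pose proof (sin2_cos2 th) as H; unfold Rsqr in H.
    replace (1 - sin th ^ 2) with (cos th * cos th) by (simpl; lra); ring.
Qed.

Lemma is_derive_integrand (b x th : R) : 0 < b -> 0 < x < 1 ->
  is_derive (fun y => integrand b y th) x
    (bulk b x (sin th ^ 2) + Re (edge' b x (sin th ^ 2))).
Proof.
intros Hb Hx.
unfold integrand.
pose proof (sin2_bounds th) as St; set (t := sin th ^ 2) in *.
assert (D : den b x t <> RtoC 0) by (apply den_neq_0; lra).
pose proof (root_neq_0 b x _ Hb Hx St) as N.
assert (Ll : is_Cderive (leg b) x (RtoC (-1))).
{ split; simpl; auto_derive; try exact I; ring. }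
assert (Ln : is_Cderive (fun y => num b y t) x (RtoC (2 - t))).
{ split; simpl; auto_derive; try exact I; ring. }
assert (Ld : is_Cderive (fun y => den b y t) x (RtoC (1 - t))).
{ split; simpl; auto_derive; try exact I; ring. }
destruct (is_Cderive_mult _ _ _ _ _ Ll
  (is_Cderive_root b (fun y => y) (fun _ => t) x _ _ Hb Hx St Ln Ld)) as [H _].
eapply is_derive_eq.
- exact (is_derive_scal (fun y => Re (leg b y * root b y t)%C) x (2 * t) _ H).
- assert (A := bulk_edge_algebra (RtoC x) (RtoC t) (leg b x)
    (num b x t) _ _ D N).
  rewrite <- !RtoC_mult, <- !RtoC_minus, <- num_leg, <- den_leg in A.
  specialize (A eq_refl eq_refl
    (root_sqr b x t Hb ltac:(lra) St)).
  apply (f_equal Re) in A; rewrite re_plus in A.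
  unfold bulk, edge'.
  rewrite <- RtoC_mult in A.
  replace (- (2 * x) * Re _) with
    (Re (- RtoC (2 * x) * / (root b x t * den b x t))%C)
    by (unfold Re; simpl; ring).
  etransitivity; [|exact A].
  cbv beta; unfold Re; simpl; ring.
Qed.

(** Continuity is proved along arbitrary [u], [v]: it is needed in [th] alone,
    to integrate, and jointly in [(x, th)], to differentiate under the
    integral. *)
Lemma continuous_bulk {T : UniformSpace} (b : R) (u v : T -> R) (p : T) :
  0 < b -> 0 < u p < 1 -> 0 <= v p <= 1 -> continuous u p -> continuous v p ->
  continuous (fun q => bulk b (u q) (v q)) p.
Proof.
intros Hb Bu Bv Hu Hv.
apply continuous_Rmult.
- apply continuous_Ropp, continuous_Rmult; [apply continuous_const|exact Hu].
- refine (proj1 (Ccontinuous_inv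
    (fun q => root b (u q) (v q) * den b (u q) (v q))%C p _ _)).
  + apply Cmult_neq_0; [apply root_neq_0|apply den_neq_0]; lra.
  + apply Ccontinuous_mult;
      [apply Ccontinuous_root | apply Ccontinuous_den]; try assumption; lra.
Qed.

Lemma Ccontinuous_edge' {T : UniformSpace} (b : R) (u v : T -> R) (p : T) :
  0 < b -> 0 < u p < 1 -> 0 <= v p <= 1 -> continuous u p -> continuous v p ->
  Ccontinuous (fun q => edge' b (u q) (v q)) p.
Proof.
intros Hb Bu Bv Hu Hv.
assert (D : den b (u p) (v p) <> RtoC 0) by (apply den_neq_0; lra).
assert (N : root b (u p) (v p) <> RtoC 0) by (apply root_neq_0; assumption).
assert (Cd := Ccontinuous_den b u v p Hu Hv).
assert (Cn := Ccontinuous_num b u v p Hu Hv).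
assert (Cr : Ccontinuous (fun q => root b (u q) (v q)) p)
  by (apply Ccontinuous_root; try assumption; lra).
apply Ccontinuous_plus.
- apply Ccontinuous_mult; [|exact Cr].
  apply Ccontinuous_RtoC, continuous_Rminus; [apply continuous_const|].
  apply continuous_Rmult; [apply continuous_const|exact Hv].
- apply Ccontinuous_div.
  + repeat apply Cmult_neq_0; assumption.
  + apply Ccontinuous_mult;
      [apply Ccontinuous_mult; [|apply Ccontinuous_leg, Hu]|].
    * apply Ccontinuous_RtoC, continuous_Rmult; [exact Hv|].
      apply continuous_Rminus; [apply continuous_const|exact Hv].
    * apply Ccontinuous_plus; [exact Cd|apply Ccontinuous_opp, Cn].
  + apply Ccontinuous_mult; [exact Cr|apply Ccontinuous_mult; exact Cd].
Qed.

(** The product of a number in the open fourth quadrant and one in the closed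
    first quadrant, both nonzero, has positive real part. *)
Lemma bulk_lt_0 (b x t : R) : 0 < b -> 0 < x < 1 -> 0 <= t <= 1 ->
  bulk b x t < 0.
Proof.
intros Hb Hx Ht; unfold bulk.
assert (H : 0 < Re (root b x t * den b x t)%C).
{ destruct (csqrt_lower (ratio b x t)) as [P M]; [apply ratio_Im_lt_0; lra|].
  fold (root b x t) in P, M.
  pose proof (den_Re_ge_1 b x t ltac:(lra) (proj1 Ht)) as Q.
  assert (I : 0 <= Im (den b x t)) by (unfold den; simpl; nra).
  set (r := root b x t) in *; set (d := den b x t) in *; clearbody r d.
  unfold Re, Im in *; simpl; nra. }
set (z := (root b x t * den b x t)%C) in *; clearbody z.
assert (K : 0 < Re (/ z)%C).
{ unfold Re in *; simpl; apply Rdiv_lt_0_compat; nra. }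
nra.
Qed.

Lemma is_derive_period (b x : R) : 0 < b -> 0 < x < 1 ->
  is_derive (period b) x
    (RInt (fun th => bulk b x (sin th ^ 2) + Re (edge' b x (sin th ^ 2)))
      0 (PI / 2)).
Proof.
intros Hb Hx.
assert (Hl : locally x (fun y : R => 0 < y < 1)).
{ apply (open_and (fun y => 0 < y) (fun y => y < 1));
    [apply open_gt|apply open_lt|exact Hx]. }
assert (H : is_derive (period b) x
  (RInt (fun th => Derive (fun y => integrand b y th) x) 0 (PI / 2))).
{ apply (is_derive_RInt_param (fun y th => integrand b y th)).
  - revert Hl; apply filter_imp; intros y Hy th _.
    eexists; apply is_derive_integrand; assumption.
  - intros th _.
    apply continuity_2d_pt_ext_loc with
      (fun u v => bulk b u (sin v ^ 2) + Re (edge' b u (sin v ^ 2))).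
    + destruct Hl as [e He].
      exists e; intros u v Hu _.
      symmetry; apply is_derive_unique, is_derive_integrand; [exact Hb|].
      apply He, Hu.
    + apply continuity_2d_pt_filterlim.
      pose proof (sin2_bounds th) as St.
      assert (Hf := continuous_fst (U := R_UniformSpace) (V := R_UniformSpace) x th).
      assert (Hs := continuous_sin2 _ _
        (continuous_snd (U := R_UniformSpace) (V := R_UniformSpace) x th)).
      refine (continuous_Rplus
        (fun q : R * R => bulk b (fst q) (sin (snd q) ^ 2))
        (fun q : R * R => Re (edge' b (fst q) (sin (snd q) ^ 2))) (x, th) _ _).
      * exact (continuous_bulk b _ _ _ Hb Hx St Hf Hs).
      * exact (proj1 (Ccontinuous_edge' b _ _ _ Hb Hx St Hf Hs)).
  - revert Hl; apply filter_imp; intros y Hy.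
    apply ex_RInt_integrand; lra. }
eapply is_derive_eq; [exact H|].
apply RInt_ext; intros th _.
apply is_derive_unique, is_derive_integrand; assumption.
Qed.

(** The edge term integrates to zero because [sin th * cos th] vanishes at
    both ends. *)
Lemma period_derive_lt_0 (b x : R) : 0 < b -> 0 < x < 1 ->
  exists l, is_derive (period b) x l /\ l < 0.
Proof.
intros Hb Hx.
eexists; split; [apply is_derive_period; assumption|].
assert (P2 : 0 < PI / 2) by (pose proof PI_RGT_0; lra).
assert (Hs : forall th, continuous (fun q : R => sin q ^ 2) th)
  by (intros th; apply (continuous_sin2 (fun q => q)), continuous_id).
assert (Cb : forall th, continuous (fun q => bulk b x (sin q ^ 2)) th).
{ intros th; apply (continuous_bulk b (fun _ => x) (fun q => sin q ^ 2));
    [exact Hb|exact Hx|apply sin2_bounds|apply continuous_const|apply Hs]. }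
assert (Ce : forall th, continuous (fun q => Re (edge' b x (sin q ^ 2))) th).
{ intros th; refine (proj1
    (Ccontinuous_edge' b (fun _ => x) (fun q => sin q ^ 2) _ _ _ _ _ _));
    [exact Hb|exact Hx|apply sin2_bounds|apply continuous_const|apply Hs]. }
assert (Ib : is_RInt (fun th => bulk b x (sin th ^ 2)) 0 (PI / 2)
  (RInt (fun th => bulk b x (sin th ^ 2)) 0 (PI / 2))).
{ apply (RInt_correct (V := R_CompleteNormedModule)).
  apply (ex_RInt_continuous (V := R_CompleteNormedModule)); intros; apply Cb. }
assert (Ie : is_RInt (fun th => Re (edge' b x (sin th ^ 2))) 0 (PI / 2)
  (Re (edge b x (PI / 2)) - Re (edge b x 0))).
{ apply (is_RInt_derive (V := R_CompleteNormedModule) (fun th => Re (edge b x th))).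
  - intros th _; exact (proj1 (is_derive_edge b x th Hb Hx)).
  - intros; apply Ce. }
assert (E0 : Re (edge b x (PI / 2)) - Re (edge b x 0) = 0).
{ unfold edge; rewrite cos_PI2, sin_0; unfold Re; simpl; ring. }
rewrite E0 in Ie.
assert (Es : RInt (fun th => bulk b x (sin th ^ 2) + Re (edge' b x (sin th ^ 2)))
  0 (PI / 2) = RInt (fun th => bulk b x (sin th ^ 2)) 0 (PI / 2) + 0).
{ apply is_RInt_unique.
  exact (is_RInt_plus (V := R_NormedModule) _ _ _ _ _ _ Ib Ie). }
rewrite Es.
assert (H : 0 < RInt (fun th => - bulk b x (sin th ^ 2)) 0 (PI / 2)).
{ apply RInt_gt_0; [exact P2| |intros; apply continuous_Ropp, Cb].
  intros th _; pose proof (bulk_lt_0 b x _ Hb Hx (sin2_bounds th)); lra. }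
assert (E : RInt (fun th => - bulk b x (sin th ^ 2)) 0 (PI / 2) =
  - RInt (fun th => bulk b x (sin th ^ 2)) 0 (PI / 2)).
{ apply is_RInt_unique.
  exact (is_RInt_opp (V := R_NormedModule) _ _ _ _ Ib). }
lra.
Qed.

Lemma period_decreasing (b x y : R) : 0 < b -> 0 < x -> x < y -> y < 1 ->
  period b y < period b x.
Proof.
intros Hb Hx Hxy Hy.
assert (D : forall z, x <= z <= y -> exists l, is_derive (period b) z l /\ l < 0)
  by (intros z Hz; apply period_derive_lt_0; lra).
destruct (MVT_gen (period b) x y (Derive (period b))) as [c [Hc E]].
- intros z; rewrite Rmin_left, Rmax_right by lra; intros Hz.
  destruct (D z) as [l [Hl _]]; [lra|].
  apply Derive_correct; eexists; exact Hl.
- intros z; rewrite Rmin_left, Rmax_right by lra; intros Hz.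
  destruct (D z) as [l [Hl _]]; [lra|].
  apply derivable_continuous_pt; exists l; apply is_derive_Reals, Hl.
- rewrite Rmin_left, Rmax_right in Hc by lra.
  destruct (D c Hc) as [l [Hl L]].
  rewrite (is_derive_unique _ _ _ Hl) in E; nra.
Qed.

(** * Signs of the period *)

(** At [x = 0] the factor [num] vanishes for [th = 0], but the integrand remains
    jointly continuous there, as [csqrt] is continuous at [0]. *)
Lemma continuous_integrand_2d (b x th : R) : 0 <= x <= 1 ->
  continuity_2d_pt (integrand b) x th.
Proof.
intros Hx; apply continuity_2d_pt_filterlim.
assert (Hf := continuous_fst (U := R_UniformSpace) (V := R_UniformSpace) x th).
assert (Hs := continuous_sin2 _ _
  (continuous_snd (U := R_UniformSpace) (V := R_UniformSpace) x th)).
refine (continuous_Rmult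
  (fun q : R * R => 2 * sin (snd q) ^ 2)
  (fun q : R * R => Re (leg b (fst q) * root b (fst q) (sin (snd q) ^ 2))%C)
  (x, th) _ _).
- apply continuous_Rmult; [apply continuous_const|exact Hs].
- refine (proj1 (Ccontinuous_mult _ _ _ (Ccontinuous_leg b _ _ Hf)
    (Ccontinuous_root b _ _ _ Hx (proj1 (sin2_bounds th)) Hf Hs))).
Qed.

Lemma period_pos_near_0 (b : R) : 0 < period b 0 ->
  exists x, 0 < x < 1 / 2 /\ 0 < period b x.
Proof.
intros HP; pose proof PI_RGT_0 as Pi.
assert (He : 0 < period b 0 / PI) by (apply Rdiv_lt_0_compat; assumption).
destruct (uniform_continuity_2d (integrand b) 0 1 0 (PI / 2)
  (fun x th Hx _ => continuous_integrand_2d b x th Hx) (mkposreal _ He)) as [d Hd].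
simpl in Hd.
pose proof (cond_pos d) as Pd.
(* [d] is a modulus of continuity at the level [period b 0 / PI], which over an
   interval of length [PI / 2] costs half of [period b 0]. *)
set (x := Rmin d (1 / 2) / 2).
assert (Hx : 0 < x /\ x < d /\ x < 1 / 2).
{ unfold x, Rmin; destruct (Rle_dec d (1 / 2)); lra. }
exists x; split; [lra|].
set (c := period b 0 / PI) in *.
assert (I0 : is_RInt (fun th => integrand b 0 th - c) 0 (PI / 2)
  (period b 0 - (PI / 2 - 0) * c)).
{ apply (is_RInt_minus (V := R_NormedModule)).
  - apply (RInt_correct (V := R_CompleteNormedModule)), ex_RInt_integrand; lra.
  - apply (is_RInt_const (V := R_NormedModule)). }
apply Rlt_le_trans with (period b 0 - (PI / 2 - 0) * c).
{ replace (period b 0) with (PI * c) by (unfold c; field; lra); nra. }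
rewrite <- (is_RInt_unique _ _ _ _ I0).
apply RInt_le; [lra|eexists; exact I0|apply ex_RInt_integrand; lra|].
intros th Hth.
assert (A : Rabs (integrand b x th - integrand b 0 th) < c).
{ apply Hd; try lra.
  - rewrite Rminus_0_r, Rabs_right; lra.
  - rewrite Rminus_diag, Rabs_R0; lra. }
apply Rabs_def2 in A; lra.
Qed.

Lemma sin2_gt_0 (th : R) : 0 < th < PI / 2 -> 0 < sin th ^ 2.
Proof. intros H; apply pow_lt, sin_gt_0; lra. Qed.

(** Under these bounds [ratio] has positive real part, so that
    [- Im root < Re root], while [- Im leg <= Re leg]: both arguments are
    between [- pi / 4] and [0], the first one strictly above [- pi / 4]. *)
Lemma period_gt_0 (b x : R) : 0 < b -> 0 < x < 1 -> b <= 1 - x ->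
  b ^ 2 <= 2 * x -> 0 < period b x.
Proof.
intros Hb Hx H1 H2; pose proof PI_RGT_0.
apply RInt_gt_0; [lra| |intros; apply continuous_integrand; lra].
intros th Hth; unfold integrand.
apply Rmult_lt_0_compat; [pose proof (sin2_gt_0 th Hth); lra|].
pose proof (sin2_bounds th) as St; set (t := sin th ^ 2) in *; clearbody t.
assert (P := den_norm2_gt_0 b x t ltac:(lra) (proj1 St)).
assert (I := ratio_Im_lt_0 b x t Hb ltac:(lra) St).
specialize (I ltac:(lra)).
assert (Q : 0 < Re (ratio b x t)).
{ rewrite ratio_Re by lra; apply Rdiv_lt_0_compat; [|exact P].
  assert (t * (1 - t) * b ^ 2 <= x / 2).
  { assert (0 <= t * (1 - t)) by nra.
    assert (t * (1 - t) <= 1 / 4) by (pose proof (pow2_ge_0 (t - 1 / 2)); nra).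
    pose proof (pow2_ge_0 b); nra. }
  assert (0 <= t * (1 - x)) by nra.
  nra. }
destruct (csqrt_lower _ I) as [R1 R2].
rewrite <- (csqrt_spec _ (Rlt_le _ _ I)) in Q.
unfold root; set (r := csqrt (ratio b x t)) in *; clearbody r.
unfold leg, Re, Im in *; simpl in *.
assert (- snd r < fst r) by nra.
nra.
Qed.

Lemma Cmod_le_sum (z : C) (a c : R) :
  Rabs (Re z) <= a -> Rabs (Im z) <= c -> Cmod z <= a + c.
Proof.
intros Ha Hc.
pose proof (Rabs_pos (Re z)); pose proof (Rabs_pos (Im z)).
apply Rsqr_incr_0_var; [|lra].
unfold Rsqr; rewrite Cmod_sqr_Re_Im.
pose proof (Rsqr_abs (Re z)) as A; pose proof (Rsqr_abs (Im z)) as B.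
unfold Rsqr in A, B; rewrite A, B.
nra.
Qed.

(** Here [Re (leg * root) = (1 - x) Re root + b Im root].  The ratio
    [- Im root / Re root] is at least [b x / (2 + b) ^ 2], because
    [2 Re root Im root = Im ratio] and [Re root ^ 2 <= Cmod ratio]; the second
    term dominates when [x] is close to [1]. *)
Lemma period_neg_near_1 (b : R) : 0 < b ->
  exists x, 1 / 2 < x < 1 /\ period b x < 0.
Proof.
intros Hb; pose proof PI_RGT_0 as Pi.
assert (EM : exists M, M = (2 + b) ^ 2) by (eexists; reflexivity).
destruct EM as [M EM].
assert (HM : b ^ 2 < M) by (rewrite EM; nra).
assert (HM0 : 0 < M) by (pose proof (pow2_ge_0 b); lra).
assert (Hq : 0 < b ^ 2 / (2 * M) < 1 / 2).
{ split; [apply Rdiv_lt_0_compat; [apply pow_lt|]; lra|].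
  apply Rmult_lt_reg_r with (2 * M); [lra|].
  replace (b ^ 2 / (2 * M) * (2 * M)) with (b ^ 2) by (field; lra). lra. }
(* [M] bounds [Cmod num * Cmod den], and [x] is chosen so that
   [(1 - x) * M = b ^ 2 / 2], which is less than [b ^ 2 * x] once [1 / 2 < x]. *)
set (x := 1 - b ^ 2 / (2 * M)).
assert (Hx : 1 / 2 < x < 1) by (unfold x; lra).
assert (Hk : (1 - x) * M < b ^ 2 * x).
{ replace ((1 - x) * M) with (b ^ 2 / 2) by (unfold x; field; lra).
  pose proof (pow_lt b 2 Hb); clearbody x; nra. }
clearbody x.
exists x; split; [exact Hx|].
assert (E : 0 < RInt (fun th => - integrand b x th) 0 (PI / 2)).
{ apply RInt_gt_0; [lra| |
    intros; apply continuous_Ropp, continuous_integrand; lra].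
  intros th Hth; unfold integrand.
  pose proof (sin2_gt_0 th Hth) as Sp.
  pose proof (sin2_bounds th) as St; set (t := sin th ^ 2) in *; clearbody t.
  assert (P := den_norm2_gt_0 b x t ltac:(lra) (proj1 St)).
  assert (I := ratio_Im_lt_0 b x t Hb ltac:(lra) St).
  specialize (I ltac:(lra)).
  enough (H : Re (leg b x * root b x t)%C < 0) by nra.
  destruct (csqrt_lower _ I) as [R1 R2].
  pose proof (csqrt_Cmod (ratio b x t)) as C1.
  pose proof (f_equal Im (csqrt_spec _ (Rlt_le _ _ I))) as C2.
  rewrite ratio_Im in C2 by lra.
  unfold root; set (r := csqrt (ratio b x t)) in *; clearbody r.
  set (D := Re (den b x t) ^ 2 + Im (den b x t) ^ 2) in *.
  assert (K : Cmod (ratio b x t) * D <= M).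
  { unfold ratio; rewrite Cmod_div by (apply den_neq_0; lra).
    assert (Z : 0 < Cmod (den b x t)) by (apply Cmod_gt_0, den_neq_0; lra).
    replace D with (Cmod (den b x t) * Cmod (den b x t))
      by (rewrite Cmod_sqr_Re_Im; unfold D; ring).
    replace (_ / _ * _) with (Cmod (num b x t) * Cmod (den b x t))
      by (field; lra).
    assert (Zn : Cmod (num b x t) <= 2 + b).
    { apply Cmod_le_sum; unfold num; simpl; apply Rabs_le; split; nra. }
    assert (Zd : Cmod (den b x t) <= 2 + b).
    { apply Cmod_le_sum; unfold den; simpl; apply Rabs_le; split; nra. }
    pose proof (Cmod_ge_0 (num b x t)); rewrite EM; nra. }
  assert (C3 : Re r * Im r * D = - (b * (x + t * (1 - x)))).
  { assert (Re r * Im r = - (2 * b * (x + t * (1 - x))) / D / 2).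
    { rewrite <- C2; unfold Re, Im; simpl; field. }
    rewrite H; field; lra. }
  assert (C4 : Re r ^ 2 * D <= M).
  { rewrite <- C1 in K.
    pose proof (Rmult_le_pos _ _ (pow2_ge_0 (Im r)) (Rlt_le _ _ P)).
    lra. }
  unfold leg, Re, Im in *; simpl.
  apply Rmult_lt_reg_r with (fst r * D); [nra|].
  replace (_ * _) with ((1 - x) * (fst r ^ 2 * D) + b * (fst r * snd r * D)) by ring.
  rewrite C3.
  assert (0 <= b ^ 2 * (t * (1 - x)))
    by (repeat apply Rmult_le_pos; simpl; lra).
  assert ((1 - x) * (fst r ^ 2 * D) <= (1 - x) * M)
    by (apply Rmult_le_compat_l; lra).
  lra. }
assert (O : RInt (fun th => - integrand b x th) 0 (PI / 2) = - period b x).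
{ apply is_RInt_unique, (is_RInt_opp (V := R_NormedModule)).
  apply (RInt_correct (V := R_CompleteNormedModule)), ex_RInt_integrand; lra. }
lra.
Qed.

(** * The degenerate endpoint x = 0 *)

(** A positive factor can be taken out of [csqrt]: at [x = 0] this isolates the
    simple zero of [root] at [th = 0], and on the segment the singular weight
    [t / (1 - t)] of [Q]. *)
Lemma csqrt_scal (s : R) (z : C) : 0 <= s ->
  csqrt (RtoC (s ^ 2) * z)%C = (RtoC s * csqrt z)%C.
Proof.
intros Hs; destruct (csqrt_args z) as [A B].
assert (E : Cmod (RtoC (s ^ 2) * z)%C = s ^ 2 * Cmod z).
{ rewrite Cmod_mult, Cmod_R, Rabs_right; [reflexivity|].
  apply Rle_ge, pow2_ge_0. }
assert (S : forall a, 0 <= a -> sqrt (s ^ 2 * a) = s * sqrt a).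
{ intros a Ha; rewrite sqrt_mult, sqrt_pow2 by (try apply pow2_ge_0; assumption).
  reflexivity. }
unfold csqrt; rewrite E; apply C_ext; simpl.
- replace (s * sqrt ((Cmod z + Re z) / 2) - 0 * - sqrt ((Cmod z - Re z) / 2))
    with (s * sqrt ((Cmod z + Re z) / 2)) by ring.
  rewrite <- S by exact A.
  f_equal; unfold Re; simpl; field.
- replace (s * - sqrt ((Cmod z - Re z) / 2) + 0 * sqrt ((Cmod z + Re z) / 2))
    with (- (s * sqrt ((Cmod z - Re z) / 2))) by ring.
  rewrite <- S by exact B.
  do 2 f_equal; unfold Re; simpl; field.
Qed.

Lemma is_derive_ln_norm (u v : R -> R) (x lu lv : R) :
  0 < u x ^ 2 + v x ^ 2 -> is_derive u x lu -> is_derive v x lv ->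
  is_derive (fun y => ln (u y ^ 2 + v y ^ 2) / 2) x
    ((u x * lu + v x * lv) / (u x ^ 2 + v x ^ 2)).
Proof.
intros P Hu Hv.
auto_derive; [repeat split; try (eexists; eassumption); simpl in P; lra|].
rewrite (is_derive_unique (fun y : R => u y) _ _ Hu),
  (is_derive_unique (fun y : R => v y) _ _ Hv).
simpl in *; field; lra.
Qed.

(** At [x = 0], [num] is [t * leg]: this is [root] without its factor
    [sqrt t]. *)
Definition reduced_root (b t : R) : C := csqrt (leg b 0 / den b 0 t)%C.

Lemma root_0 (b s : R) : 0 <= s ->
  root b 0 (s ^ 2) = (RtoC s * reduced_root b (s ^ 2))%C.
Proof.
intros Hs; unfold reduced_root; rewrite <- csqrt_scal by exact Hs.
unfold root, ratio; f_equal.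
rewrite num_leg, Rmult_0_r; unfold Cdiv; ring.
Qed.

Lemma reduced_Im (b t : R) : 0 < b -> 0 <= t <= 1 ->
  Im (leg b 0 / den b 0 t)%C < 0.
Proof.
intros Hb Ht; pose proof (den_norm2_gt_0 b 0 t ltac:(lra) (proj1 Ht)) as P.
replace (Im _) with (- (2 * b / (Re (den b 0 t) ^ 2 + Im (den b 0 t) ^ 2))).
- assert (0 < 2 * b / (Re (den b 0 t) ^ 2 + Im (den b 0 t) ^ 2))
    by (apply Rdiv_lt_0_compat; lra).
  lra.
- unfold leg, den, Re, Im in *; simpl in *; field; lra.
Qed.

(** With [s = point], one has [s - 1 = - (1 - t) leg] and [s + 1 = den], and
    [cofactor ^ 2 = leg * den]; so [i * cos th * cofactor] is a square root of
    [s ^ 2 - 1] which is smooth in [th], also at [th = pi / 2], where [s = 1].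
    [logarg] is [s + sqrt (s ^ 2 - 1)], and [primitive] the real part of
    [i sqrt (s ^ 2 - 1) + b log (s + sqrt (s ^ 2 - 1))]. *)
Definition cofactor (b t : R) : C := (leg b 0 / reduced_root b t)%C.
Definition point (b t : R) : C := (RtoC 1 - RtoC (1 - t) * leg b 0)%C.
Definition logarg (b th : R) : C :=
  (point b (sin th ^ 2) + Ci * (RtoC (cos th) * cofactor b (sin th ^ 2)))%C.
Definition primitive (b th : R) : R :=
  - Re (RtoC (cos th) * cofactor b (sin th ^ 2))%C +
  b * (ln (Re (logarg b th) ^ 2 + Im (logarg b th) ^ 2) / 2).

Lemma primitive_algebra (l e d c s : C) :
  e <> RtoC 0 -> d <> RtoC 0 -> l <> RtoC 0 -> (e * e * d)%C = l ->
  d = (RtoC 2 - c * c * l)%C ->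
  (- s * (l / e) + c * (s * c * l * e) =
   - (RtoC 2 * s * e * (RtoC 1 - c * c * l)))%C.
Proof.
intros He Hd Hl E D.
assert (F : (l / e)%C = (e * d)%C) by (rewrite <- E; field; exact He).
rewrite F, D; ring.
Qed.

Lemma cofactor_derive_algebra (l e d k : C) :
  e <> RtoC 0 -> d <> RtoC 0 -> (e * e * d)%C = l ->
  ((RtoC 0 * e -
    l * ((RtoC 0 * d - l * (RtoC 2 * k * l)) / (d * d) / (RtoC 2 * e))) /
   (e * e) = k * l * e)%C.
Proof.
intros He Hd E.
rewrite <- E; field; split; assumption.
Qed.

Lemma is_Cderive_cofactor (b th : R) : 0 < b ->
  is_Cderive (fun y => cofactor b (sin y ^ 2)) th
    (RtoC (sin th * cos th) * leg b 0 * reduced_root b (sin th ^ 2))%C.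
Proof.
intros Hb.
pose proof (sin2_bounds th) as St.
assert (D : den b 0 (sin th ^ 2) <> RtoC 0) by (apply den_neq_0; lra).
assert (I := reduced_Im b _ Hb St).
assert (N := csqrt_neq_0 _ I).
assert (Ld : is_Cderive (fun y => den b 0 (sin y ^ 2)) th
  (RtoC 2 * RtoC (sin th * cos th) * leg b 0)%C).
{ split; simpl; auto_derive; try exact Logic.I; ring. }
eapply is_Cderive_eq.
- exact (is_Cderive_div (fun _ => leg b 0)
    (fun y => csqrt (leg b 0 / den b 0 (sin y ^ 2))%C) th _ _ N
    (is_Cderive_const (leg b 0) th)
    (is_Cderive_csqrt (fun y => leg b 0 / den b 0 (sin y ^ 2))%C th _ I
      (is_Cderive_div (fun _ => leg b 0) (fun y => den b 0 (sin y ^ 2)) th _ _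
        D (is_Cderive_const (leg b 0) th) Ld))).
- cbv beta; fold (reduced_root b (sin th ^ 2)); apply cofactor_derive_algebra;
    [exact N|exact D|].
  unfold reduced_root; rewrite csqrt_spec by lra; field; exact D.
Qed.

Lemma is_derive_primitive (b th : R) : 0 < b ->
  is_derive (primitive b) th
    (2 * sin th ^ 2 *
      Re (leg b 0 * (RtoC (sin th) * reduced_root b (sin th ^ 2)))%C).
Proof.
intros Hb.
pose proof (sin2_bounds th) as St.
assert (D : den b 0 (sin th ^ 2) <> RtoC 0) by (apply den_neq_0; lra).
assert (I := reduced_Im b _ Hb St).
assert (N := csqrt_neq_0 _ I); fold (reduced_root b (sin th ^ 2)) in N.
assert (L : leg b 0 <> RtoC 0) by (apply C_Re_neq_0; simpl; lra).
assert (E : (reduced_root b (sin th ^ 2) * reduced_root b (sin th ^ 2) *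
  den b 0 (sin th ^ 2))%C = leg b 0).
{ unfold reduced_root; rewrite csqrt_spec by lra; field; exact D. }
assert (T : 1 - sin th ^ 2 = cos th * cos th).
{ pose proof (sin2_cos2 th) as H; unfold Rsqr in H; simpl; lra. }
assert (P : is_Cderive (fun y => point b (sin y ^ 2)) th
  (RtoC 2 * RtoC (sin th * cos th) * leg b 0)%C).
{ split; simpl; auto_derive; try exact Logic.I; ring. }
assert (Cc : is_Cderive (fun y => RtoC (cos y)) th (RtoC (- sin th))).
{ apply is_Cderive_RtoC; auto_derive; [exact Logic.I|ring]. }
assert (W := is_Cderive_mult _ _ _ _ _ Cc (is_Cderive_cofactor b th Hb)).
cbv beta in W.
set (e := reduced_root b (sin th ^ 2)) in *.
assert (Ed := den_leg b 0 (sin th ^ 2)).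
rewrite T in Ed.
assert (W' : is_Cderive (fun y => RtoC (cos y) * cofactor b (sin y ^ 2))%C th
  (- (RtoC 2 * RtoC (sin th) * e * point b (sin th ^ 2)))%C).
{ eapply is_Cderive_eq; [exact W|].
  unfold cofactor, point; fold e; rewrite T, !RtoC_mult.
  rewrite RtoC_opp.
  apply (primitive_algebra (leg b 0) e (den b 0 (sin th ^ 2)));
   try assumption. rewrite Ed, RtoC_mult; reflexivity. }
assert (K : (leg b 0 / e)%C = (e * den b 0 (sin th ^ 2))%C)
  by (rewrite <- E; field; exact N).
assert (I2 : (Ci * Ci)%C = (- RtoC 1)%C) by (apply C_ext; simpl; ring).
(* The logarithmic derivative of [s + sqrt (s ^ 2 - 1)] is
   [s' / sqrt (s ^ 2 - 1) = - 2 i sin th e], regular at [s = 1]. *)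
assert (V : is_Cderive (logarg b) th
  (- (RtoC 2 * Ci * RtoC (sin th) * e) * logarg b th)%C).
{ eapply is_Cderive_eq.
  - exact (is_Cderive_plus _ _ _ _ _ P
     (is_Cderive_mult (fun _ => Ci) _ _ _ _ (is_Cderive_const Ci th) W')).
  - unfold logarg, cofactor; fold e; rewrite K, RtoC_mult.
    transitivity (RtoC 2 * (RtoC (sin th) * RtoC (cos th)) * leg b 0 -
      RtoC 2 * Ci * RtoC (sin th) * e * point b (sin th ^ 2))%C; [ring|].
    rewrite <- E at 1.
    transitivity (- (Ci * Ci) * RtoC 2 * RtoC (sin th) * RtoC (cos th) *
       (e * e * den b 0 (sin th ^ 2)) -
      RtoC 2 * Ci * RtoC (sin th) * e * point b (sin th ^ 2))%C; [|ring].
    rewrite I2; ring. }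
(* [s + sqrt (s ^ 2 - 1)] is inverse to [s - sqrt (s ^ 2 - 1)]. *)
assert (V0 : logarg b th <> RtoC 0).
{ intros V0.
  assert (H : (logarg b th * (point b (sin th ^ 2) -
    Ci * (RtoC (cos th) * cofactor b (sin th ^ 2))))%C = RtoC 1).
  { unfold logarg, cofactor; fold e; rewrite K.
    transitivity (point b (sin th ^ 2) * point b (sin th ^ 2) - (Ci * Ci) *
      RtoC (cos th) * RtoC (cos th) * (e * e * den b 0 (sin th ^ 2)) *
      den b 0 (sin th ^ 2))%C; [ring|].
    rewrite I2, E, Ed; unfold point; rewrite T, RtoC_mult; ring. }
  rewrite V0, Cmult_0_l in H; apply (f_equal Re) in H; simpl in H; lra. }
assert (V1 : 0 < Re (logarg b th) ^ 2 + Im (logarg b th) ^ 2)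
  by (pose proof (C_norm2_gt_0 _ V0); nra).
set (k := (- (RtoC 2 * Ci * RtoC (sin th) * e))%C) in *.
assert (HL : is_derive
  (fun y => ln (Re (logarg b y) ^ 2 + Im (logarg b y) ^ 2) / 2) th (Re k)).
{ eapply is_derive_eq.
  - exact (is_derive_ln_norm (fun y => Re (logarg b y))
      (fun y => Im (logarg b y)) _ _ _ V1 (proj1 V) (proj2 V)).
  - revert V1; cbv beta; clear; generalize (logarg b th) k; intros v c V1.
unfold Re, Im in *; simpl in *; field; lra. }
assert (HW := is_derive_opp (K := R_AbsRing) (V := R_NormedModule) _ _ _ (proj1 W')).
eapply is_derive_eq.
- exact (is_derive_plus (K := R_AbsRing) (V := R_NormedModule) _ _ _ _ _ HW
    (is_derive_scal (fun y => ln (Re (logarg b y) ^ 2 + Im (logarg b y) ^ 2) / 2)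
      _ b _ HL)).
- unfold k, plus, opp, point, leg, Re, Im; simpl; ring.
Qed.

(** The square of [cofactor] is [1 + b ^ 2] at the initial point; the sign of
    the root follows from the quadrants of [leg] and [csqrt]. *)
Lemma cofactor_0 (b : R) : 0 < b -> cofactor b 0 = RtoC (sqrt (1 + b ^ 2)).
Proof.
intros Hb.
assert (I := reduced_Im b 0 Hb ltac:(lra)).
destruct (csqrt_lower _ I) as [R1 R2].
assert (N := csqrt_neq_0 _ I).
assert (D : den b 0 0 <> RtoC 0) by (apply den_neq_0; lra).
assert (S := csqrt_spec _ (Rlt_le _ _ I)).
fold (reduced_root b 0) in R1, R2, N, S.
assert (K : (cofactor b 0 * cofactor b 0)%C = RtoC (1 + b ^ 2)).
{ unfold cofactor.
  transitivity (leg b 0 * leg b 0 / (reduced_root b 0 * reduced_root b 0))%C;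
    [field; exact N|].
  rewrite S; transitivity (leg b 0 * den b 0 0)%C.
  - field; split; [exact D|apply C_Re_neq_0; simpl; lra].
  - apply C_ext; unfold leg, den; simpl; ring. }
assert (P : 0 < Re (cofactor b 0)).
{ unfold cofactor; set (e := reduced_root b 0) in *; clearbody e.
  replace (Re _) with ((Re e - b * Im e) / (Re e ^ 2 + Im e ^ 2)).
  - apply Rdiv_lt_0_compat; nra.
  - unfold leg, Re, Im in *; simpl; field; nra. }
set (k := cofactor b 0) in *; clearbody k.
assert (Kr := f_equal Re K); assert (Ki := f_equal Im K).
unfold Re, Im in *; simpl in Kr, Ki.
assert (K2 : snd k = 0) by nra.
apply C_ext; simpl; [|exact K2].
rewrite K2 in Kr; symmetry; apply Rsqr_inj;
  [apply sqrt_pos|apply Rlt_le, P|].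
unfold Rsqr; rewrite sqrt_sqrt by nra; unfold Re; simpl; lra.
Qed.

Lemma period_0 (b : R) : 0 < b ->
  period b 0 = sqrt (1 + b ^ 2) - b * ln (b + sqrt (1 + b ^ 2)).
Proof.
intros Hb; pose proof PI_RGT_0 as Pi.
assert (H0 : primitive b 0 =
  - sqrt (1 + b ^ 2) + b * ln (b + sqrt (1 + b ^ 2))).
{ pose proof (sqrt_pos (1 + b ^ 2)).
  unfold primitive, logarg; rewrite sin_0, cos_0, pow_i by auto.
  rewrite cofactor_0 by exact Hb.
  set (r := sqrt (1 + b ^ 2)) in *.
  replace (Re _ ^ 2 + Im _ ^ 2) with ((b + r) * (b + r))
    by (unfold point, leg; simpl; ring).
  rewrite ln_mult by lra; simpl; field. }
assert (H1 : primitive b (PI / 2) = 0).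
{ unfold primitive, logarg; rewrite sin_PI2, cos_PI2, pow1.
  replace (Re (point _ _ + _) ^ 2 + Im _ ^ 2) with 1
    by (unfold point, leg; simpl; ring).
  rewrite ln_1, Cmult_0_l; simpl; lra. }
replace (sqrt _ - _) with (primitive b (PI / 2) - primitive b 0)
  by (rewrite H0, H1; ring).
apply is_RInt_unique.
apply (is_RInt_derive (V := R_CompleteNormedModule) (primitive b) (integrand b 0)).
- intros th; rewrite Rmin_left, Rmax_right by lra; intros Hth.
  unfold integrand; rewrite root_0 by (apply sin_ge_0; lra).
  apply is_derive_primitive, Hb.
- intros; apply continuous_integrand; lra.
Qed.

(** * Holomorphy of the square root of Q *)

(** The target carries the structure of the field over itself, for which the
    product and chain rules are available; [holomorphic_ex_derive] passes to the
    structure used by [sqrt_branch]. *)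
Definition holomorphic_at (f : C -> C) (z : C) : Prop :=
  ex_derive (K := C_AbsRing) (V := AbsRing_NormedModule C_AbsRing) f z.

Lemma holomorphic_ex_derive (f : C -> C) (z : C) :
  holomorphic_at f z <-> ex_derive (K := C_AbsRing) (V := C_NormedModule) f z.
Proof.
split; intros [l [_ H]]; exists l; split; try apply is_linear_scal_l; exact H.
Qed.

Lemma holomorphic_quadratic (f : C -> C) (z l : C) (M : R) : 0 < M ->
  locally (T := C_UniformSpace) z
    (fun y => Cmod (f y - f z - (y - z) * l) <= M * Cmod (y - z) ^ 2) ->
  holomorphic_at f z.
Proof.
intros HM H; exists l; split; [apply is_linear_scal_l|].
intros y Hy.
assert (E : z = y) by exact (is_filter_lim_locally_unique (K := C_AbsRing)
  (V := AbsRing_NormedModule C_AbsRing) z y Hy).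
subst y.
intros eps; apply locally_C in H.
assert (He : 0 < eps / M) by (apply Rdiv_lt_0_compat; [apply cond_pos|exact HM]).
assert (B := locally_ball (T := AbsRing_UniformSpace C_AbsRing) z (mkposreal _ He)).
generalize (filter_and _ _ H B); apply filter_imp.
intros y [H1 H2].
change (Cmod (y - z) < eps / M) in H2.
change (Cmod (f y - f z - (y - z) * l) <= eps * Cmod (y - z)).
eapply Rle_trans; [exact H1|].
pose proof (Cmod_ge_0 (y - z)).
apply Rmult_lt_compat_r with (r := M) in H2; [|exact HM].
replace (eps / M * M) with (pos eps) in H2 by (field; lra).
replace (M * Cmod (y - z) ^ 2) with ((Cmod (y - z) * M) * Cmod (y - z)) by ring.
apply Rmult_le_compat_r; lra.
Qed.

Lemma locally_Cmod (z : C) (e : R) : 0 < e ->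
  locally (T := C_UniformSpace) z (fun y => Cmod (y - z) < e).
Proof.
intros He; apply locally_C.
exact (locally_ball (T := AbsRing_UniformSpace C_AbsRing) z (mkposreal _ He)).
Qed.

Lemma Cmod_ge_half (y z : C) : Cmod (y - z) < Cmod z / 2 -> Cmod z / 2 < Cmod y.
Proof.
intros H.
assert (T := Cmod_triangle y (- (y - z))%C).
rewrite Cmod_opp in T; replace (y + - (y - z))%C with z in T by ring; lra.
Qed.

Lemma holomorphic_inv (z : C) : z <> RtoC 0 -> holomorphic_at Cinv z.
Proof.
intros Hz; assert (P := proj1 (Cmod_gt_0 z) Hz).
apply holomorphic_quadratic with (- / (z * z))%C (2 / (Cmod z * Cmod z * Cmod z)).
{ apply Rdiv_lt_0_compat; [lra|]. repeat apply Rmult_lt_0_compat; exact P. }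
assert (P2 : 0 < Cmod z / 2) by lra.
generalize (locally_Cmod z _ P2); apply filter_imp; intros y Hy.
apply Cmod_ge_half in Hy.
assert (Ny : y <> RtoC 0) by (apply Cmod_gt_0; lra).
replace (/ y - / z - (y - z) * - / (z * z))%C with
  ((y - z) * (y - z) / (z * z * y))%C by (field; split; assumption).
rewrite Cmod_div by (repeat apply Cmult_neq_0; assumption).
rewrite !Cmod_mult.
replace (2 / (Cmod z * Cmod z * Cmod z) * Cmod (y - z) ^ 2) with
  (Cmod (y - z) * Cmod (y - z) * / (Cmod z * Cmod z * (Cmod z / 2)))
  by (field; lra).
apply Rmult_le_compat_l; [apply Rmult_le_pos; apply Cmod_ge_0|].
apply Rinv_le_contravar.
- repeat apply Rmult_lt_0_compat; lra.
- apply Rmult_le_compat_l; [apply Rmult_le_pos; lra|lra].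
Qed.

(** From [csqrt y - csqrt z = (y - z) / (csqrt y + csqrt z)] the error of the
    linear approximation is
    [- (y - z) ^ 2 / (2 csqrt z (csqrt y + csqrt z) ^ 2)], which
    [csqrt_sum_ge] bounds by a multiple of [Cmod (y - z) ^ 2]. *)
Lemma holomorphic_csqrt (z : C) : Im z < 0 -> holomorphic_at csqrt z.
Proof.
intros Hz; assert (N := csqrt_neq_0 z Hz).
assert (Nz : z <> RtoC 0) by (apply C_Im_neq_0; lra).
assert (P := proj1 (Cmod_gt_0 _) N).
set (m := Cmod (csqrt z)) in *.
apply holomorphic_quadratic with (/ (RtoC 2 * csqrt z))%C (/ (m * m * m)).
{ apply Rinv_0_lt_compat; repeat apply Rmult_lt_0_compat; exact P. }
assert (Pz : 0 < - Im z) by lra.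
generalize (locally_Cmod z _ Pz); apply filter_imp; intros y Hy.
assert (Iy : Im y < 0).
{ pose proof (Rmax_Cmod (y - z)%C) as H.
  pose proof (Rmax_r (Rabs (fst (y - z)%C)) (Rabs (snd (y - z)%C))) as H'.
  pose proof (Rle_abs (snd (y - z)%C)) as H''.
  simpl in *; unfold Im in *; lra. }
set (a := csqrt z) in *; set (c := csqrt y).
assert (Ea : (a * a)%C = z) by (apply csqrt_spec; lra).
assert (Ec : (c * c)%C = y) by (apply csqrt_spec; lra).
assert (S : m <= Cmod (c + a)).
{ apply Rsqr_incr_0_var; [|apply Cmod_ge_0].
  unfold Rsqr; rewrite (Cmod_sqr_Re_Im (c + a)%C).
  replace (m * m) with (Cmod z) by (rewrite <- Ea, Cmod_mult; reflexivity).
  rewrite Cplus_comm; pose proof (csqrt_sum_ge z y).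
  fold a c in H; lra. }
assert (Ns : (c + a)%C <> RtoC 0) by (apply Cmod_gt_0; lra).
replace (c - a - (y - z) * / (RtoC 2 * a))%C with
  (- ((y - z) * (y - z)) / (RtoC 2 * a * ((c + a) * (c + a))))%C.
2: { rewrite <- Ea, <- Ec; field; split; assumption. }
rewrite Cmod_div by (repeat apply Cmult_neq_0; try assumption;
  apply C_Re_neq_0; simpl; lra).
rewrite Cmod_opp, !Cmod_mult, Cmod_R, Rabs_right by lra.
fold m.
replace (/ (m * m * m) * Cmod (y - z) ^ 2) with
  (Cmod (y - z) * Cmod (y - z) * / (m * m * m)) by ring.
apply Rmult_le_compat_l; [apply Rmult_le_pos; apply Cmod_ge_0|].
apply Rinv_le_contravar; [repeat apply Rmult_lt_0_compat; exact P|].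
assert (m * m <= Cmod (c + a) * Cmod (c + a)) by nra.
nra.
Qed.

Lemma holomorphic_mult (f g : C -> C) (z : C) :
  holomorphic_at f z -> holomorphic_at g z ->
  holomorphic_at (fun y => (f y * g y)%C) z.
Proof.
intros [lf Hf] [lg Hg]; eexists.
exact (is_derive_mult (K := C_AbsRing) f g z lf lg Hf Hg Cmult_comm).
Qed.

Lemma holomorphic_plus (f g : C -> C) (z : C) :
  holomorphic_at f z -> holomorphic_at g z ->
  holomorphic_at (fun y => (f y + g y)%C) z.
Proof.
exact (ex_derive_plus (K := C_AbsRing) (V := AbsRing_NormedModule C_AbsRing)
  f g z).
Qed.

Lemma holomorphic_const (c z : C) : holomorphic_at (fun _ => c) z.
Proof.
exact (ex_derive_const (K := C_AbsRing) (V := AbsRing_NormedModule C_AbsRing)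
  c z).
Qed.

Lemma holomorphic_id (z : C) : holomorphic_at (fun y => y) z.
Proof. exact (ex_derive_id (K := C_AbsRing) z). Qed.

Lemma holomorphic_comp (f g : C -> C) (z : C) :
  holomorphic_at f (g z) -> holomorphic_at g z ->
  holomorphic_at (fun y => f (g y)) z.
Proof.
exact (ex_derive_comp (K := C_AbsRing) (V := AbsRing_NormedModule C_AbsRing)
  f g z).
Qed.

Lemma holomorphic_Ccontinuous (f : C -> C) (z : C) :
  holomorphic_at f z -> Ccontinuous (T := C_UniformSpace) f z.
Proof.
intros H; apply ex_derive_continuous in H.
assert (K : continuous (T := C_UniformSpace) (U := C_UniformSpace) f z).
{ intros P HP; apply locally_C; apply H; apply locally_C; exact HP. }
split.
- apply (continuous_comp (V := C_UniformSpace) f (fun w : C => fst w)); [exact K|].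
  destruct (f z); apply continuous_fst.
- apply (continuous_comp (V := C_UniformSpace) f (fun w : C => snd w)); [exact K|].
  destruct (f z); apply continuous_snd.
Qed.

Lemma holomorphic_Q (lambda x : R) (z : C) : (z ^ 2 - RtoC 1)%C <> RtoC 0 ->
  holomorphic_at (Q lambda x) z.
Proof.
intros Hz; unfold Q.
apply holomorphic_mult; [apply holomorphic_const|].
apply holomorphic_mult.
- apply holomorphic_mult; apply holomorphic_plus;
    first [apply holomorphic_id|apply holomorphic_const].
- apply (holomorphic_comp Cinv (fun y => y ^ 2 - RtoC 1)%C).
  + apply holomorphic_inv, Hz.
  + apply holomorphic_plus; [|apply holomorphic_const].
    apply (holomorphic_mult (fun y => y) (fun y => (y * RtoC 1)%C));
      [apply holomorphic_id|].
    apply holomorphic_mult; [apply holomorphic_id|apply holomorphic_const].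
Qed.

(** The branch lives on the preimage of the lower half-plane.  This set omits
    the poles [1] and [-1], because division by zero gives the value zero
    there. *)
Lemma sqrt_branch_csqrt (lambda x : R) (a c : C) :
  (forall t, 0 < t < 1 -> Im (Q lambda x (segment a c t)) < 0) ->
  sqrt_branch (Q lambda x) a c (fun z => csqrt (Q lambda x z)).
Proof.
intros H; exists (fun z => Im (Q lambda x z) < 0).
assert (HQ : forall z, Im (Q lambda x z) < 0 -> holomorphic_at (Q lambda x) z).
{ intros z Hz; apply holomorphic_Q; intros E.
  unfold Q in Hz; rewrite E in Hz.
  replace (Im _) with 0 in Hz; [lra|].
  unfold Cdiv, Im; simpl; unfold Rdiv; ring. }
split; [|split].
- intros z Hz.
  destruct (holomorphic_Ccontinuous _ _ (HQ z Hz)) as [_ K].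
  apply (K (fun r => r < 0)).
  exact (open_lt 0 _ Hz).
- exact H.
- intros z Hz; split.
  + apply holomorphic_ex_derive, (holomorphic_comp csqrt (Q lambda x)); [|apply HQ, Hz].
    apply holomorphic_csqrt, Hz.
  + etransitivity; [|apply csqrt_spec; lra]. simpl; ring.
Qed.

(** * The improper integral *)

Lemma is_RInt_gen_pair {Fa Fb : (R -> Prop) -> Prop} {FFa : Filter Fa}
  {FFb : Filter Fb} (f : R -> C) (l : C) :
  is_RInt_gen (V := R_NormedModule) (fun t => Re (f t)) Fa Fb (Re l) ->
  is_RInt_gen (V := R_NormedModule) (fun t => Im (f t)) Fa Fb (Im l) ->
  is_RInt_gen (V := C_R_NormedModule) f Fa Fb l.
Proof.
intros Hr Hi P [e He].
assert (Br : locally (Re l) (fun r => ball (Re l) e r)) by (exists e; tauto).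
assert (Bi : locally (Im l) (fun r => ball (Im l) e r)) by (exists e; tauto).
apply Hr in Br; apply Hi in Bi; unfold filtermapi in *.
generalize (filter_and _ _ Br Bi); apply filter_imp.
intros ab [[r [Ir Pr]] [i [Ii Pi]]].
exists (r, i); split; [|apply He; split; assumption].
exact (is_RInt_fct_extend_pair (U := R_NormedModule) (V := R_NormedModule)
  f _ _ r i Ir Ii).
Qed.

Lemma asin_sqrt_0 :
  filterlim (fun t => asin (sqrt t)) (at_right 0) (locally 0).
Proof.
apply filterlim_locally; intros e; pose proof PI_RGT_0 as Pi.
set (a := Rmin e (PI / 2) / 2).
assert (Ha : 0 < a /\ a < e /\ a < PI / 2).
{ pose proof (cond_pos e); unfold a, Rmin.
  destruct (Rle_dec e (PI / 2)); lra. }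
assert (Sa : 0 < sin a) by (apply sin_gt_0; lra).
assert (Sp : 0 < sin a ^ 2) by (apply pow_lt, Sa).
exists (mkposreal _ Sp); intros t Ht T0.
change (Rabs (t - 0) < sin a ^ 2) in Ht.
rewrite Rminus_0_r, Rabs_right in Ht by lra.
change (Rabs (asin (sqrt t) - 0) < e).
assert (St : 0 <= sqrt t) by apply sqrt_pos.
assert (S1 : sqrt t < sin a).
{ rewrite <- (sqrt_pow2 (sin a)) by lra; apply sqrt_lt_1; lra. }
pose proof (SIN_bound a) as B1.
pose proof (asin_bound (sqrt t)) as B2.
assert (U : asin (sqrt t) < a).
{ apply Rnot_le_lt; intros L.
  apply (sin_incr_1 a (asin (sqrt t))) in L; try lra.
  rewrite sin_asin in L; lra. }
assert (L : 0 <= asin (sqrt t)).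
{ apply Rnot_lt_le; intros L.
  apply (sin_increasing_1 (asin (sqrt t)) 0) in L; try lra.
  rewrite sin_asin, sin_0 in L; lra. }
rewrite Rminus_0_r, Rabs_right; lra.
Qed.

Lemma asin_sqrt_1 :
  filterlim (fun t => asin (sqrt t)) (at_left 1) (locally (PI / 2)).
Proof.
apply filterlim_locally; intros e; pose proof PI_RGT_0 as Pi.
set (a := PI / 2 - Rmin e (PI / 2) / 2).
assert (Ha : 0 < a /\ PI / 2 - e < a /\ a < PI / 2).
{ pose proof (cond_pos e); unfold a, Rmin.
  destruct (Rle_dec e (PI / 2)); lra. }
assert (Sa : 0 < sin a) by (apply sin_gt_0; lra).
assert (Sa1 : sin a < 1) by (rewrite <- sin_PI2; apply sin_increasing_1; lra).
assert (Sp : 0 < 1 - sin a ^ 2) by nra.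
exists (mkposreal _ Sp); intros t Ht T1.
change (Rabs (t - 1) < 1 - sin a ^ 2) in Ht.
rewrite Rabs_left in Ht by lra.
change (Rabs (asin (sqrt t) - PI / 2) < e).
assert (S1 : sin a < sqrt t).
{ rewrite <- (sqrt_pow2 (sin a)) by lra.
  pose proof (pow2_ge_0 (sin a)); apply sqrt_lt_1; lra. }
assert (S2 : sqrt t < 1).
{ rewrite <- sqrt_1; pose proof (pow2_ge_0 (sin a)); apply sqrt_lt_1; lra. }
pose proof (asin_bound (sqrt t)) as B2.
assert (U : a < asin (sqrt t)).
{ apply Rnot_le_lt; intros L.
  apply (sin_incr_1 (asin (sqrt t)) a) in L; try lra.
  rewrite sin_asin in L; lra. }
rewrite Rabs_left1; lra.
Qed.

Lemma sin2_asin_sqrt (t : R) : 0 < t < 1 ->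
  0 < asin (sqrt t) < PI / 2 /\ sin (asin (sqrt t)) ^ 2 = t.
Proof.
intros Ht.
assert (S0 := sqrt_lt_R0 t (proj1 Ht)).
assert (S1 : sqrt t < 1) by (rewrite <- sqrt_1; apply sqrt_lt_1; lra).
assert (E : sin (asin (sqrt t)) = sqrt t) by (apply sin_asin; lra).
assert (B := asin_bound_lt (sqrt t) ltac:(lra)).
split; [split; [|lra]|].
- apply Rnot_le_lt; intros L.
  apply (sin_incr_1 (asin (sqrt t)) 0) in L; try lra.
  rewrite E, sin_0 in L; lra.
- rewrite E; apply pow2_sqrt; lra.
Qed.

Lemma is_RInt_sin2 (g : R -> R) (a c : R) : 0 < a < 1 -> 0 < c < 1 ->
  (forall t, 0 < t < 1 -> continuous g t) ->
  is_RInt (fun t => sqrt (t / (1 - t)) * g t) a c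
    (RInt (fun th => 2 * sin th ^ 2 * g (sin th ^ 2))
      (asin (sqrt a)) (asin (sqrt c))).
Proof.
intros Ha Hc Hg.
destruct (sin2_asin_sqrt a Ha) as [Aa Ea].
destruct (sin2_asin_sqrt c Hc) as [Ac Ec].
set (f := fun t => sqrt (t / (1 - t)) * g t).
assert (Hf : forall t, 0 < t < 1 -> continuous f t).
{ intros t Ht; apply continuous_Rmult; [|apply Hg, Ht].
  apply continuous_Rsqrt, continuous_Rdiv; [lra|apply continuous_id|].
  apply continuous_Rminus; [apply continuous_const|apply continuous_id]. }
assert (Hth : forall th, Rmin (asin (sqrt a)) (asin (sqrt c)) <= th <=
  Rmax (asin (sqrt a)) (asin (sqrt c)) -> 0 < th < PI / 2).
{ intros th; unfold Rmin, Rmax; destruct (Rle_dec _ _); lra. }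
assert (Hs : forall th, 0 < th < PI / 2 ->
  0 < sin th /\ 0 < cos th /\ 1 - sin th ^ 2 = cos th ^ 2).
{ intros th H; split; [apply sin_gt_0; lra|].
  split; [apply cos_gt_0; lra|].
  pose proof (sin2_cos2 th) as T; unfold Rsqr in T; simpl; lra. }
assert (E : RInt (fun th => 2 * sin th ^ 2 * g (sin th ^ 2))
  (asin (sqrt a)) (asin (sqrt c)) = RInt f a c).
{ rewrite <- Ea at 2; rewrite <- Ec at 2.
  rewrite <- (RInt_comp f (fun th => sin th ^ 2)
    (fun th => 2 * sin th * cos th)).
  - apply RInt_ext; intros th H.
    destruct (Hs th) as [S1 [S2 S3]]; [apply Hth; lra|].
    unfold scal, f; simpl; unfold mult; simpl.
    change (sin th * (sin th * 1)) with (sin th ^ 2); rewrite S3.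
    replace (sin th ^ 2 / cos th ^ 2) with ((sin th / cos th) ^ 2)
      by (field; lra).
    rewrite sqrt_pow2 by (apply Rlt_le, Rdiv_lt_0_compat; assumption).
    field; lra.
  - intros th H; apply Hf.
    destruct (Hs th (Hth th H)) as [S1 [S2 S3]].
    split; [apply pow_lt, S1|].
    pose proof (pow_lt _ 2 S2); lra.
  - intros th H; split; [auto_derive; [exact I|ring]|].
    apply continuous_Rmult; [apply continuous_Rmult|];
      [apply continuous_const|apply continuous_sin|apply continuous_cos]. }
rewrite E; apply (RInt_correct (V := R_CompleteNormedModule)).
apply (ex_RInt_continuous (V := R_CompleteNormedModule)).
intros t Ht; apply Hf; revert Ht; unfold Rmin, Rmax; destruct (Rle_dec _ _); lra.
Qed.

Lemma endpoints_in_unit_interval :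
  filter_prod (at_right 0) (at_left 1)
    (fun ab : R * R => 0 < fst ab < 1 /\ 0 < snd ab < 1).
Proof.
exists (fun a => 0 < a < 1) (fun c => 0 < c < 1).
- exists (mkposreal 1 Rlt_0_1); intros y Hy Y.
  change (Rabs (y - 0) < 1) in Hy; apply Rabs_def2 in Hy; lra.
- exists (mkposreal 1 Rlt_0_1); intros y Hy Y.
  change (Rabs (y - 1) < 1) in Hy; apply Rabs_def2 in Hy; lra.
- intros u v Hu Hv; split; assumption.
Qed.

(** Between interior points the integral is that of a function continuous on
    the whole line, between bounds [asin (sqrt t)] which extend continuously to
    both endpoints. *)
Lemma is_RInt_gen_sin2 (g : R -> R) :
  (forall t, 0 < t < 1 -> continuous g t) ->
  (forall th, continuous (fun q => g (sin q ^ 2)) th) ->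
  is_RInt_gen (V := R_NormedModule) (fun t => sqrt (t / (1 - t)) * g t)
    (at_right 0) (at_left 1)
    (RInt (fun th => 2 * sin th ^ 2 * g (sin th ^ 2)) 0 (PI / 2)).
Proof.
intros Hg Hs.
set (G := fun th => 2 * sin th ^ 2 * g (sin th ^ 2)).
assert (CG : forall th, continuous G th).
{ intros th; apply continuous_Rmult; [|apply Hs].
  apply continuous_Rmult; [apply continuous_const|].
  apply (continuous_sin2 (fun q => q)), continuous_id. }
assert (L : filterlim
  (fun ab : R * R => RInt G (asin (sqrt (fst ab))) (asin (sqrt (snd ab))))
  (filter_prod (at_right 0) (at_left 1)) (locally (RInt G 0 (PI / 2)))).
{ apply (filterlim_comp_2 (G := locally 0) (H := locally (PI / 2))
    (fun ab : R * R => asin (sqrt (fst ab)))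
    (fun ab : R * R => asin (sqrt (snd ab))) (RInt G)).
  - apply (filterlim_comp _ _ _ fst (fun t => asin (sqrt t)) _ (at_right 0));
      [apply filterlim_fst|apply asin_sqrt_0].
  - apply (filterlim_comp _ _ _ snd (fun t => asin (sqrt t)) _ (at_left 1));
      [apply filterlim_snd|apply asin_sqrt_1].
  - assert (K := continuous_RInt (V := R_NormedModule) G 0 (PI / 2) (RInt G)).
    intros P HP; destruct (K) with (P := P) as [e He].
    + exists (mkposreal 1 Rlt_0_1); intros z _.
      apply (RInt_correct (V := R_CompleteNormedModule)).
      apply (ex_RInt_continuous (V := R_CompleteNormedModule)); intros; apply CG.
    + exact HP.
    + exists (fun y => ball 0 e y) (fun y => ball (PI / 2) e y).
      * apply locally_ball.
      * apply locally_ball.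
      * intros u v Hu Hv; apply (He (u, v)); split; assumption. }
intros P HP.
assert (R0 := endpoints_in_unit_interval).
apply L in HP; unfold filtermap in HP; unfold filtermapi.
generalize (filter_and _ _ HP R0); apply filter_imp.
intros [a c] [H1 [Ha Hc]]; simpl in *.
eexists; split; [|exact H1].
apply is_RInt_sin2; assumption.
Qed.

Lemma is_RInt_gen_root (b x : R) : 0 < b -> 0 < x < 1 ->
  exists J : C, Re J = period b x /\
  is_RInt_gen (V := C_R_NormedModule)
    (fun t => RtoC (sqrt (t / (1 - t))) * (leg b x * root b x t))%C
    (at_right 0) (at_left 1) J.
Proof.
intros Hb Hx.
assert (C1 : forall t, 0 < t < 1 ->
  Ccontinuous (fun t => leg b x * root b x t)%C t).
{ intros t Ht; apply Ccontinuous_mult.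
  - apply Ccontinuous_leg, continuous_const.
  - apply (Ccontinuous_root b (fun _ => x) (fun q => q));
      [lra|lra|apply continuous_const|apply continuous_id]. }
assert (C2 : forall th,
  Ccontinuous (fun q => leg b x * root b x (sin q ^ 2))%C th).
{ intros th; apply Ccontinuous_mult.
  - apply Ccontinuous_leg, continuous_const.
  - apply (Ccontinuous_root b (fun _ => x) (fun q => sin q ^ 2));
      [lra|apply sin2_bounds|apply continuous_const|].
    apply (continuous_sin2 (fun q => q)), continuous_id. }
assert (Er : forall (k : R) (z : C), Re (RtoC k * z)%C = k * Re z)
  by (intros; unfold Re; simpl; ring).
assert (Ei : forall (k : R) (z : C), Im (RtoC k * z)%C = k * Im z)
  by (intros; unfold Im; simpl; ring).
exists (period b x,
  RInt (fun th => 2 * sin th ^ 2 * Im (leg b x * root b x (sin th ^ 2))%C)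
    0 (PI / 2)).
split; [reflexivity|apply is_RInt_gen_pair].
- eapply is_RInt_gen_ext; [|apply (is_RInt_gen_sin2
    (fun t => Re (leg b x * root b x t)%C))].
  + apply filter_forall; intros ab t _; symmetry; apply Er.
  + intros t Ht; exact (proj1 (C1 t Ht)).
  + intros th; exact (proj1 (C2 th)).
- eapply is_RInt_gen_ext; [|apply (is_RInt_gen_sin2
    (fun t => Im (leg b x * root b x t)%C))].
  + apply filter_forall; intros ab t _; symmetry; apply Ei.
  + intros t Ht; exact (proj2 (C1 t Ht)).
  + intros th; exact (proj2 (C2 th)).
Qed.

(** * From branches of the square root to the period *)

Lemma z_pt_eq (lambda x : R) : 0 < lambda -> z_pt lambda x = (x, 2 / lambda).
Proof.
intros Hl; apply C_ext; unfold z_pt; simpl; field; lra.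
Qed.

Lemma one_minus_z_pt (lambda x : R) : 0 < lambda ->
  (RtoC 1 - z_pt lambda x)%C = leg (2 / lambda) x.
Proof.
intros Hl; rewrite z_pt_eq by exact Hl; apply C_ext; unfold leg; simpl; ring.
Qed.

Lemma Q_algebra (k t l n d : C) : l <> RtoC 0 -> d <> RtoC 0 ->
  (RtoC 1 - t)%C <> RtoC 0 ->
  (- k * ((t * l) * n / (- (RtoC 1 - t) * l * d)) =
   k * (t / (RtoC 1 - t)) * (n / d))%C.
Proof. intros; field; repeat split; assumption. Qed.

Lemma Q_segment (lambda x t : R) : 0 < lambda -> 0 < x < 1 -> 0 < t < 1 ->
  Q lambda x (segment (z_pt lambda x) (RtoC 1) t) =
  (RtoC ((lambda / 2 * sqrt (t / (1 - t))) ^ 2) * ratio (2 / lambda) x t)%C.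
Proof.
intros Hl Hx Ht.
set (b := 2 / lambda).
assert (Z : z_pt lambda x = (x, b)) by (apply z_pt_eq, Hl).
assert (S : segment (z_pt lambda x) (RtoC 1) t =
  (z_pt lambda x + RtoC t * leg b x)%C)
  by (unfold segment; rewrite one_minus_z_pt by exact Hl; reflexivity).
assert (L : leg b x <> RtoC 0) by (apply C_Re_neq_0; simpl; lra).
assert (D : den b x t <> RtoC 0) by (apply den_neq_0; lra).
unfold Q; rewrite S.
replace (z_pt lambda x + RtoC t * leg b x - z_pt lambda x)%C
  with (RtoC t * leg b x)%C by ring.
replace (z_pt lambda x + RtoC t * leg b x + Cconj (z_pt lambda x))%C
  with (num b x t)
  by (rewrite Z; apply C_ext; unfold num, leg; simpl; ring).
replace ((z_pt lambda x + RtoC t * leg b x) ^ 2 - RtoC 1)%C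
  with (- (RtoC 1 - RtoC t) * leg b x * den b x t)%C
  by (rewrite Z; apply C_ext; unfold den, leg; simpl; ring).
rewrite Q_algebra; [|exact L|exact D|apply C_Re_neq_0; simpl; lra].
unfold ratio; f_equal.
rewrite <- RtoC_minus, <- RtoC_div by lra.
rewrite <- RtoC_mult; f_equal.
rewrite Rpow_mult_distr, pow2_sqrt by (apply Rlt_le, Rdiv_lt_0_compat; lra).
field; lra.
Qed.

Lemma sqrt_weight_gt_0 (lambda t : R) : 0 < lambda -> 0 < t < 1 ->
  0 < lambda / 2 * sqrt (t / (1 - t)).
Proof.
intros Hl Ht; apply Rmult_lt_0_compat; [lra|].
apply sqrt_lt_R0, Rdiv_lt_0_compat; lra.
Qed.

(** By the intermediate value theorem a continuous function cannot pass from
    [-1] to [1] without vanishing. *)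
Lemma continuous_sign_constant (q : R -> R) :
  (forall t, 0 < t < 1 -> continuous q t) ->
  (forall t, 0 < t < 1 -> q t = 1 \/ q t = -1) ->
  forall t, 0 < t < 1 -> q t = q (1 / 2).
Proof.
intros Hc Hq.
assert (K : forall (f : R -> R) a c, (forall t, 0 < t < 1 -> continuous f t) ->
  (forall t, 0 < t < 1 -> f t = 1 \/ f t = -1) ->
  0 < a -> a < c -> c < 1 -> f a = -1 -> f c = 1 -> False).
{ intros f a c Fc Fq Ha Hac Hc1 Ea Ec.
  destruct (IVT_interv f a c) as [z [Hz Ez]]; try lra.
  - intros z Hz; apply continuity_pt_filterlim, Fc; lra.
  - destruct (Fq z); lra. }
assert (M : forall a c, 0 < a < 1 -> 0 < c < 1 -> a < c -> q a = q c).
{ intros a c Ha Hc1 Hac.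
  destruct (Hq a Ha) as [Ea | Ea], (Hq c Hc1) as [Ec | Ec]; try lra; exfalso.
  - apply (K (fun t => - q t) a c); try lra.
    + intros t Ht; apply continuous_Ropp, Hc, Ht.
    + intros t Ht; destruct (Hq t Ht); lra.
  - apply (K q a c); try assumption; lra. }
intros t Ht; destruct (Rtotal_order t (1 / 2)) as [H | [H | H]].
- apply M; lra.
- rewrite H; reflexivity.
- symmetry; apply M; lra.
Qed.

Lemma continuous_branch_segment (a c : C) (w : C -> C) (t : R) :
  holomorphic_at w (segment a c t) -> Ccontinuous (fun u => w (segment a c u)) t.
Proof.
intros H; destruct (holomorphic_Ccontinuous _ _ H) as [Wr Wi].
assert (S : continuous (U := C_UniformSpace) (fun u : R => segment a c u) t).
{ assert (Z : continuous (fun u : R => Re (segment a c u)) t /\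
    continuous (fun u : R => Im (segment a c u)) t).
  { split; unfold segment; simpl;
      apply (continuous_Rplus (fun _ => _));
      try apply continuous_const; [apply continuous_Rminus|apply continuous_Rplus];
      apply continuous_Rmult; try apply continuous_const; apply continuous_id. }
  destruct Z as [Zr Zi].
  apply (continuous_ext (fun u => (Re (segment a c u), Im (segment a c u)))).
  - intros u; unfold Re, Im; symmetry; apply surjective_pairing.
  - intros P HP.
    destruct HP as [e He].
    assert (Br := Zr _ (locally_ball (Re (segment a c t)) e)).
    assert (Bi := Zi _ (locally_ball (Im (segment a c t)) e)).
    unfold filtermap in *.
    generalize (filter_and _ _ Br Bi); apply filter_imp; intros u Hu.
    apply He; exact Hu. }
split.
- exact (continuous_comp (V := C_UniformSpace) _ (fun z => Re (w z)) t S Wr).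
- exact (continuous_comp (V := C_UniformSpace) _ (fun z => Im (w z)) t S Wi).
Qed.

(** Any branch divided by [lambda / 2 * sqrt (t / (1 - t)) * root] is a
    continuous function on [(0, 1)] with square [1], hence a constant sign [s];
    its integral is [s * (lambda / 2)] times the complex integral [J] with real
    part [period].  Conversely [csqrt] of [Q] is the branch with [s = 1]. *)
Lemma re_integral_vanishes_iff (lambda x : R) : 0 < lambda -> 0 < x < 1 ->
  re_integral_vanishes lambda x <-> period (2 / lambda) x = 0.
Proof.
intros Hl Hx; set (b := 2 / lambda).
assert (Hb : 0 < b) by (apply Rdiv_lt_0_compat; lra).
destruct (is_RInt_gen_root b x Hb Hx) as [J [HJ IJ]].
assert (U : forall s : R, is_RInt_gen (V := C_R_NormedModule)
  (fun t => RtoC (s * (lambda / 2 * sqrt (t / (1 - t)))) * root b x t *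
    leg b x)%C (at_right 0) (at_left 1) (RtoC (s * (lambda / 2)) * J)%C).
{ intros s.
  replace (RtoC (s * (lambda / 2)) * J)%C
    with (scal (V := C_R_NormedModule) (s * (lambda / 2)) J)
    by (apply C_ext; unfold scal; simpl; unfold scal; simpl;
      unfold mult, Re, Im; simpl; ring).
  eapply is_RInt_gen_ext; [|exact (is_RInt_gen_scal _ (s * (lambda / 2)) _ IJ)].
  apply filter_forall; intros ab t _.
  apply C_ext; unfold scal; simpl; unfold scal; simpl;
      unfold mult, Re, Im; simpl; ring. }
assert (B := endpoints_in_unit_interval).
assert (X : forall (w : C -> C) (s : R),
  (forall t, 0 < t < 1 -> w (segment (z_pt lambda x) (RtoC 1) t) =
    (RtoC (s * (lambda / 2 * sqrt (t / (1 - t)))) * root b x t)%C) ->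
  is_segment_integral w (z_pt lambda x) (RtoC 1) (RtoC (s * (lambda / 2)) * J)%C).
{ intros w s Hw.
  eapply is_RInt_gen_ext; [|exact (U s)].
  revert B; apply filter_imp; intros [a c] [Ha Hc] t; simpl in *; intros Ht.
  rewrite Hw, one_minus_z_pt by
    (revert Ht; unfold Rmin, Rmax; destruct (Rle_dec a c); lra).
  reflexivity. }
assert (E : forall s, Re (RtoC (s * (lambda / 2)) * J)%C = s * (lambda / 2) * period b x).
{ intros s; rewrite <- HJ; unfold Re; simpl; ring. }
split.
- intros [w [I [[O [_ [HO HW]]] [HI I0]]]].
  set (r := fun t => (RtoC (lambda / 2 * sqrt (t / (1 - t))) * root b x t)%C).
  assert (Nr : forall t, 0 < t < 1 -> r t <> RtoC 0).
  { intros t Ht; apply Cmult_neq_0.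
    - apply C_Re_neq_0; pose proof (sqrt_weight_gt_0 lambda t Hl Ht); simpl; lra.
    - apply root_neq_0; lra. }
  set (q := fun t => (w (segment (z_pt lambda x) (RtoC 1) t) / r t)%C).
  assert (Q2 : forall t, 0 < t < 1 -> q t = RtoC 1 \/ q t = RtoC (-1)).
  { intros t Ht.
    assert (H : ((q t - RtoC 1) * (q t + RtoC 1))%C = RtoC 0).
    { destruct (HW _ (HO t Ht)) as [_ H].
      rewrite Q_segment in H by assumption; fold b in H.
      unfold q.
      set (v := w (segment (z_pt lambda x) (RtoC 1) t)) in *.
      assert (H2 : (v * v)%C = (r t * r t)%C).
      { transitivity (v ^ 2)%C; [simpl; ring|rewrite H; unfold r].
        rewrite <- (csqrt_spec (ratio b x t)) by (apply Rlt_le, ratio_Im_lt_0; lra).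
        fold (root b x t); rewrite RtoC_pow; simpl; ring. }
      transitivity ((v * v - r t * r t) / (r t * r t))%C;
        [field; apply Nr, Ht|rewrite H2; field; apply Nr, Ht]. }
    destruct (Ceq_dec (q t) (RtoC 1)) as [H1 | H1]; [left; exact H1|right].
    destruct (Ceq_dec (q t + RtoC 1)%C (RtoC 0)) as [H2 | H2].
    - transitivity (q t + RtoC 1 - RtoC 1)%C; [ring|].
      rewrite H2; apply C_ext; simpl; ring.
    - exfalso; revert H; apply Cmult_neq_0; [|exact H2].
      intros H; apply H1; transitivity (q t - RtoC 1 + RtoC 1)%C; [ring|].
      rewrite H; ring. }
  assert (Cq : forall t, 0 < t < 1 -> Ccontinuous q t).
  { intros t Ht; apply Ccontinuous_div; [apply Nr, Ht| |].
    - apply continuous_branch_segment, holomorphic_ex_derive, (HW _ (HO t Ht)).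
    - apply Ccontinuous_mult.
      + apply Ccontinuous_RtoC, continuous_Rmult; [apply continuous_const|].
        apply continuous_Rsqrt, continuous_Rdiv; [lra|apply continuous_id|].
        apply continuous_Rminus; [apply continuous_const|apply continuous_id].
      + apply (Ccontinuous_root b (fun _ => x) (fun t => t));
          [lra|lra|apply continuous_const|apply continuous_id]. }
  assert (R2 : forall t, 0 < t < 1 -> Re (q t) = 1 \/ Re (q t) = -1).
  { intros t Ht; destruct (Q2 t Ht) as [H | H]; rewrite H; [left|right]; reflexivity. }
  assert (Cs := continuous_sign_constant (fun t => Re (q t))
    (fun t Ht => proj1 (Cq t Ht)) R2).
  set (s := Re (q (1 / 2))) in Cs.
  assert (Hs : s <> 0) by (destruct (R2 (1 / 2)); unfold s; lra).
  assert (HI' := X w s).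
  assert (Hw : I = (RtoC (s * (lambda / 2)) * J)%C).
  { unfold is_segment_integral in HI.
    rewrite <- (is_RInt_gen_unique (V := C_R_CompleteNormedModule) _ _ HI).
    apply (is_RInt_gen_unique (V := C_R_CompleteNormedModule)), HI'.
    intros t Ht.
    transitivity (RtoC s * r t)%C; [|unfold r; rewrite (RtoC_mult s); ring].
    rewrite <- (Cs t Ht).
    replace (RtoC (Re (q t))) with (q t)
      by (destruct (Q2 t Ht) as [H | H]; rewrite H; reflexivity).
    unfold q; field; apply Nr, Ht. }
  rewrite Hw, E in I0.
  apply Rmult_integral in I0; destruct I0 as [I0 | I0]; [|exact I0].
  apply Rmult_integral in I0; destruct I0; lra.
- intros H0.
  assert (W : forall t, 0 < t < 1 ->
    csqrt (Q lambda x (segment (z_pt lambda x) (RtoC 1) t)) =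
    (RtoC (1 * (lambda / 2 * sqrt (t / (1 - t)))) * root b x t)%C).
  { intros t Ht; rewrite Q_segment by assumption.
    rewrite Rmult_1_l; apply csqrt_scal, Rlt_le, sqrt_weight_gt_0; assumption. }
  exists (fun z => csqrt (Q lambda x z)), (RtoC (1 * (lambda / 2)) * J)%C.
  split; [|split].
  + apply sqrt_branch_csqrt; intros t Ht; rewrite Q_segment by assumption.
    fold b.
    assert (P := ratio_Im_lt_0 b x t Hb ltac:(lra) ltac:(lra) ltac:(lra)).
    assert (P2 := pow_lt _ 2 (sqrt_weight_gt_0 lambda t Hl Ht)).
    set (k := (_ * _) ^ 2) in *; clearbody k.
    replace (Im _) with (k * Im (ratio b x t)) by (unfold Im; simpl; ring).
    nra.
  + apply (X (fun z => csqrt (Q lambda x z))), W.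
  + rewrite E, H0; ring.
Qed.

(** * Existence, uniqueness and limit of the zero *)

Lemma sqrt_scaled (lambda : R) : 0 < lambda ->
  sqrt (lambda ^ 2 + 4) = lambda * sqrt (1 + (2 / lambda) ^ 2).
Proof.
intros Hl.
replace (lambda ^ 2 + 4) with (lambda ^ 2 * (1 + (2 / lambda) ^ 2))
  by (field; lra).
pose proof (pow2_ge_0 (2 / lambda)).
rewrite sqrt_mult, sqrt_pow2 by (try apply pow2_ge_0; lra); reflexivity.
Qed.

(** Up to the factor [b / 2], the closed form of [period b 0] is minus the
    left-hand side of the equation for [lambda_c], which decreases with
    [lambda]. *)
Lemma period_0_gt_0 (lambda : R) : lambda_c < lambda -> 0 < period (2 / lambda) 0.
Proof.
intros Hl.
destruct lambda_c_correct as [[H0 Hc] _].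
assert (P : 0 < lambda) by lra.
assert (D := critical_decreasing _ _ H0 Hl).
unfold critical_eq in Hc; rewrite Hc in D.
rewrite period_0 by (apply Rdiv_lt_0_compat; lra).
rewrite sqrt_scaled in D by exact P.
set (r := sqrt (1 + (2 / lambda) ^ 2)) in *.
replace ((2 + lambda * r) / lambda) with (2 / lambda + r) in D by (field; lra).
replace (r - 2 / lambda * ln (2 / lambda + r)) with
  (- (2 * ln (2 / lambda + r) - lambda * r) / lambda) by (field; lra).
apply Rdiv_lt_0_compat; lra.
Qed.

Lemma period_root_exists (b : R) : 0 < b -> 0 < period b 0 ->
  exists x, 0 < x < 1 /\ period b x = 0.
Proof.
intros Hb H0.
destruct (period_pos_near_0 b H0) as [u [Hu Pu]].
destruct (period_neg_near_1 b Hb) as [v [Hv Pv]].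
destruct (IVT_interv (fun x => - period b x) u v) as [x [Hx Ex]]; try lra.
- intros x Hx.
  destruct (period_derive_lt_0 b x Hb ltac:(lra)) as [l [Hl _]].
  apply continuity_pt_filterlim, continuous_Ropp.
  apply (ex_derive_continuous (K := R_AbsRing) (V := R_NormedModule)).
  exists l; exact Hl.
- exists x; split; lra.
Qed.

Theorem theorem2p1 :
  (forall lambda : R, lambda_c < lambda ->
     exists! x : R, 0 < x < 1 /\ re_integral_vanishes lambda x) /\
  (forall x_star : R -> R,
     (forall lambda : R, lambda_c < lambda ->
        0 < x_star lambda < 1 /\ re_integral_vanishes lambda (x_star lambda)) ->
     is_lim x_star p_infty 1).
Proof.
destruct lambda_c_correct as [[C0 _] _].
split.
- intros lambda Hl.
  assert (Hb : 0 < 2 / lambda) by (apply Rdiv_lt_0_compat; lra).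
  destruct (period_root_exists _ Hb (period_0_gt_0 _ Hl)) as [x [Hx Ex]].
  exists x; split.
  + split; [exact Hx|apply re_integral_vanishes_iff; [lra|exact Hx|exact Ex]].
  + intros y [Hy Ey]; apply re_integral_vanishes_iff in Ey; [|lra|exact Hy].
    destruct (Rtotal_order x y) as [H | [H | H]]; [|exact H|].
    * pose proof (period_decreasing _ x y Hb (proj1 Hx) H (proj2 Hy)); lra.
    * pose proof (period_decreasing _ y x Hb (proj1 Hy) H (proj2 Hx)); lra.
- intros xs Hxs; apply is_lim_spec; intros e.
  set (d := Rmin e (1 / 2) / 2).
  assert (Hd : 0 < d /\ d < e /\ d < 1 / 2).
  { pose proof (cond_pos e); unfold d, Rmin; destruct (Rle_dec e (1 / 2)); lra. }
  exists (Rmax lambda_c (2 / d)); intros lambda Hl.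
  pose proof (Rmax_l lambda_c (2 / d)); pose proof (Rmax_r lambda_c (2 / d)).
  destruct (Hxs lambda) as [Hx Ex]; [lra|].
  apply re_integral_vanishes_iff in Ex; [|lra|exact Hx].
  assert (Hb : 0 < 2 / lambda) by (apply Rdiv_lt_0_compat; lra).
  assert (Hbd : 2 / lambda <= d).
  { apply Rmult_le_reg_r with (lambda / d).
    - apply Rdiv_lt_0_compat; lra.
    - replace (2 / lambda * (lambda / d)) with (2 / d) by (field; lra).
      replace (d * (lambda / d)) with lambda by (field; lra). lra. }
  set (b := 2 / lambda) in *.
  assert (G : 0 < period b (1 - d)) by (apply period_gt_0; nra).
  assert (K : 1 - d < xs lambda).
  { apply Rnot_le_lt; intros [L | L].
    - pose proof (period_decreasing b (xs lambda) (1 - d) Hb ltac:(lra) L); lra.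
    - rewrite L in Ex; lra. }
  apply Rabs_lt_between; lra.
Qed.
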